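(* For Lebesgue-almost every triple $(a,b,c)\in(0,1)^3$ the following holds: every (finite) outerplanar graph $G$ has a degenerate drawing using only edge-lengths $a$, $b$ and $c$; that is, there is an injective map $f:V_G\to\mathbb{C}$ such that $|f(u)-f(v)|\in\{a,b,c\}$ for every edge $uv$ of $G$.
   Context: An outerplanar graph is a graph that can be embedded in the plane without crossings so that all its vertices lie on the boundary of the unbounded face. A degenerate drawing of a graph $G$ is a map sending the vertices of $G$ to pairwise distinct points of the plane (identified with $\mathbb{C}$); the image of an edge $uv$ is the open segment between the images of $u$ and $v$, which is allowed to pass through images of other vertices. The edge-length of $uv$ is $|f(u)-f(v)|$. ''Using only edge-lengths $a,b,c$'' means every edge-length lies in $\{a,b,c\}$. *)

(* Defs.v *)
From HB Require Import structures.
From mathcomp Require Import all_boot all_order all_algebra.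
From mathcomp Require Import complex.
From mathcomp Require Import all_classical all_reals all_analysis.

Set Implicit Arguments.
Unset Strict Implicit.
Unset Printing Implicit Defensive.
Import Order.TTheory GRing.Theory Num.Theory.
Import numFieldNormedType.Exports.

Local Open Scope classical_set_scope.
Local Open Scope ring_scope.

Definition simple_graph (V : finType) (e : rel V) : Prop :=
  symmetric e /\ irreflexive e.

(* [g u v], for [e u v], parametrises by [0, 1] the Jordan arc representing
   the edge uv, traversed from u to v; [g v u] traverses the same arc
   backwards. *)
Record plane_embedding (R : realType) (V : finType) (e : rel V)
    (p : V -> R * R) (g : V -> V -> R -> R * R) : Prop := PlaneEmbedding {
  plane_vertex_inj : injective p;
  plane_edge_continuous : forall u v, e u v ->
    {within `[0, 1], continuous (g u v)};
  plane_edge_inj : forall u v, e u v -> {in `[0, 1] &, injective (g u v)};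
  plane_edge_start : forall u v, e u v -> g u v 0 = p u;
  plane_edge_end : forall u v, e u v -> g u v 1 = p v;
  plane_edge_rev : forall u v, e u v ->
    {in `[0, 1], forall t, g v u t = g u v (1 - t)};
  plane_edge_vertex : forall u v w, e u v ->
    ~ (g u v @` `]0, 1[) (p w);
  plane_edge_disjoint : forall u v x y, e u v -> e x y ->
    ~ (u = x /\ v = y \/ u = y /\ v = x) ->
    (g u v @` `]0, 1[) `&` (g x y @` `]0, 1[) = set0
}.

Definition drawing_support (R : realType) (V : finType) (e : rel V)
    (p : V -> R * R) (g : V -> V -> R -> R * R) : set (R * R) :=
  range p `|` [set z | exists u v, e u v /\ (g u v @` `[0, 1]) z].

Definition is_face (R : realType) (D F : set (R * R)) : Prop :=
  exists2 z, (~` D) z & F = connected_component (~` D) z.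

Definition boundary (T : topologicalType) (A : set T) : set T :=
  closure A `\` A°.

Definition outerplanar (R : realType) (V : finType) (e : rel V) : Prop :=
  exists (p : V -> R * R) (g : V -> V -> R -> R * R),
    plane_embedding e p g /\
    exists F : set (R * R),
      [/\ is_face (drawing_support e p g) F,
          ~ bounded_set F
        & forall v, boundary F (p v)].

Definition degenerate_drawing (R : realType) (V : finType) (f : V -> R[i]) :
  Prop := injective f.

Definition uses_edge_lengths (R : realType) (V : finType) (e : rel V)
    (f : V -> R[i]) (a b c : R) : Prop :=
  forall u v, e u v -> `|f u - f v| \in [:: a%:C%C; b%:C%C; c%:C%C].

(* Main.v *)
(** Adding to the drawing of an outerplanar graph a point of the outer face,
    joined to each vertex by a continuum that meets only arcs at that vertex,
    would turn a K4 or K23 minor into a drawing of K5 or K33 in which disjoint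
    edges have disjoint images.  This is impossible: subdividing the edges finely
    and counting mod 2 the crossings of the differences with the negative
    half-axis gives one relation for each pair of disjoint edges, and the sum of
    all these relations is [0 = 1].

    A graph without K4 and K23 minors embeds into the Farey graph, i.e. the
    infinite triangulation grown from one edge by putting again and again a new
    vertex in front of each edge.  The triangles of the Farey graph are glued in
    pairs into rhombi of side [1] with a diagonal of length [|1 - x|] or
    [|1 - y|], where [|x| = |y| = 1].  The positions of the vertices are then
    polynomials in [x] and [y] with integer coefficients.  With [x] and [y]
    alternating along each strip of rhombi these polynomials are pairwise
    distinct, so the drawing is injective as soon as [x] and [y] are
    algebraically independent.

    If [a] is the largest length, scaling by [a] gives edge lengths [a], [b] and
    [c] for [x], [y] on the unit circle at distances [c / a], [b / a] from [1];
    by Fubini these are algebraically independent for almost all triples. *)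

Require Import Defs.
From HB Require Import structures.
From Stdlib Require Import Bool Ring.
From mathcomp Require Import all_boot.

Set Implicit Arguments.
Unset Strict Implicit.
Unset Printing Implicit Defensive.

(** * Graphs without K4 and K23 minors embed into the Farey graph *)

(** Outerplanarity enters only through the two excluded minors, used as families of disjoint
    connected vertex sets.

    A straight segment from a vertex to a nearby point of the outer face may run across arcs at that
    vertex. The nonplanarity statements are therefore about continua and leave edges with a common
    end free to meet. The image of an edge between two branch sets can then be the whole drawing of
    their union.

    Farey addresses are assigned by recursion on intervals: a vertex adjacent to the left end goes
    to the mediant and splits what remains. The excluded minors provide a vertex that leaves no
    component attached to both ends, since such a component would fit on neither side.

    Two variables are used because of neighbouring rhombi. The strips leaving the rhombi [j] and
    [j.+1] through the same rail of their strip each have a rail starting at the vertex shared by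
    the two rhombi. With one variable these two rails would coincide; alternating the variables
    gives them different directions. *)

Section GraphComponents.
Variables (V : finType) (e : rel V).
Hypotheses (e_sym : symmetric e) (e_irr : irreflexive e).

Implicit Types (A B C D E P : {set V}) (u v w x y z : V).

(** * Connected vertex sets and components of induced subgraphs *)

Definition induced A : rel V := [rel x y | [&& x \in A, y \in A & e x y]].

Lemma inducedE A x y : induced A x y = [&& x \in A, y \in A & e x y].
Proof. by []. Qed.

Definition component A x : {set V} := [set y | connect (induced A) x y].

Definition conn A : Prop :=
  (exists x, x \in A) /\ {in A &, forall x y, connect (induced A) x y}.

Definition linked A B : Prop := exists x y, [/\ x \in A, y \in B & e x y].

Lemma linkedC A B : linked A B -> linked B A.
Proof. by move=> [x [y [xA yB exy]]]; exists y, x; rewrite e_sym. Qed.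

Lemma linked_sub A A' B B' :
  A \subset A' -> B \subset B' -> linked A B -> linked A' B'.
Proof.
move=> /subsetP sA /subsetP sB [x [y [xA yB exy]]].
by exists x, y; split=> //; [apply: sA | apply: sB].
Qed.

Lemma connect_induced_sym A : connect_sym (induced A).
Proof.
apply: sym_connect_sym => x y; rewrite /induced /= [e x y]e_sym.
by case: (x \in A); rewrite ?andbF.
Qed.

Lemma connect_inducedS A B x y :
  A \subset B -> connect (induced A) x y -> connect (induced B) x y.
Proof.
move=> /subsetP sAB; apply: connect_sub => a b /and3P[aA bA eab].
by apply: connect1; rewrite inducedE !sAB.
Qed.

Lemma conn_root A x :
  x \in A -> {in A, forall y, connect (induced A) x y} -> conn A.
Proof.
move=> xA Hx; split; first by exists x.
move=> y z yA zA; apply: (connect_trans (y := x)); last exact: Hx.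
by rewrite connect_induced_sym; apply: Hx.
Qed.

Lemma conn1 x : conn [set x].
Proof.
by apply: (conn_root (x := x)); rewrite ?set11 // => y /set1P->.
Qed.

Lemma connU A B : conn A -> conn B -> linked A B -> conn (A :|: B).
Proof.
move=> [_ cA] [_ cB] [x [y [xA yB exy]]].
apply: (conn_root (x := x)); first by rewrite inE xA.
move=> z; rewrite inE => /orP[zA|zB].
  by apply: (connect_inducedS (subsetUl A B)); apply: cA.
apply: (connect_trans (y := y)).
  by apply: connect1; rewrite inducedE !inE xA yB exy orbT.
by apply: (connect_inducedS (subsetUr A B)); apply: cB.
Qed.

Lemma conn_pair u v : e u v -> conn [set u; v].
Proof.
move=> euv; apply: connU (conn1 u) (conn1 v) _.
by exists u, v; rewrite !set11.
Qed.

Lemma component_refl A x : x \in component A x.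
Proof. by rewrite inE connect0. Qed.

Lemma component_sub A x : x \in A -> component A x \subset A.
Proof.
move=> xA; apply/subsetP => y; rewrite inE => /connectP[p pp ->].
elim: p x xA pp => [|z p IH] x xA //= /andP[/and3P[_ zA _] pp].
exact: IH pp.
Qed.

Lemma component_in A x y : x \in A -> y \in component A x -> y \in A.
Proof. by move=> xA; apply/subsetP/component_sub. Qed.

Lemma component_eq A x y :
  y \in component A x -> component A y = component A x.
Proof.
rewrite inE => cxy; apply/setP => z; rewrite !inE.
by rewrite (same_connect (connect_induced_sym A) cxy).
Qed.

Lemma conn_component A x : x \in A -> conn (component A x).
Proof.
move=> xA; apply: (conn_root (component_refl A x)) => y.
rewrite inE => /connectP[p pp ->].
have Cp : all (fun z => z \in component A x) (x :: p).
  apply/allP => z zp; rewrite inE.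
  case/splitPl: zp pp => p1 p2 <-; rewrite cat_path => /andP[pp1 _].
  by apply/connectP; exists p1.
have sub q t : path (induced A) t q ->
    all (fun z => z \in component A x) (t :: q) ->
    connect (induced (component A x)) t (last t q).
  elim: q t => [|z q IH] t //= /andP[/and3P[_ _ etz] pq] /and3P[tC zC qC].
  apply: (connect_trans (y := z)); last by apply: IH => //=; rewrite zC.
  by apply: connect1; rewrite inducedE tC zC.
exact: sub.
Qed.

Lemma component_max A B x :
  conn B -> B \subset A -> x \in B -> B \subset component A x.
Proof.
move=> [_ cB] sBA xB; apply/subsetP => y yB; rewrite inE.
exact: connect_inducedS sBA (cB _ _ xB yB).
Qed.

Lemma component_step A x y z :
  x \in A -> y \in component A x -> z \in A -> e y z -> z \in component A x.
Proof.
move=> xA yC zA eyz; have yA := component_in xA yC.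
rewrite -(component_eq yC) inE.
by apply: connect1; rewrite inducedE yA zA.
Qed.

Lemma conn_exit A C x y : conn A -> x \in A -> x \in C -> y \in A ->
  y \notin C -> exists a b, [/\ a \in A, a \in C, b \in A, b \notin C & e a b].
Proof.
move=> [_ cA] xA xC yA yC; have /connectP[p pp def_y] := cA _ _ xA yA.
elim: p x xA xC pp def_y => [|z p IH] x xA xC /=.
  by move=> _ def_y; rewrite def_y xC in yC.
move=> /andP[/and3P[_ zA exz] pp] def_y.
by have [zC|zC] := boolP (z \in C); [apply: IH pp def_y | exists x, z].
Qed.

Lemma component_cut D v x : conn D -> v \in D -> x \in D :\ v ->
  exists2 y, y \in component (D :\ v) x & e v y.
Proof.
move=> cD vD xDv; have xD : x \in D by case/setD1P: xDv.
have vC : v \notin component (D :\ v) x.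
  by apply/negP => /(component_in xDv); rewrite !inE eqxx.
have [a [b [aD aC bD bC eab]]] := conn_exit cD xD (component_refl _ _) vD vC.
exists a => //; rewrite e_sym; have [->//|nbv] := eqVneq v b.
case/negP: bC; apply: (component_step xDv aC _ eab).
by rewrite !inE eq_sym nbv.
Qed.

(** Each of the other components of [D :\ v] is adjacent to [v], so they all hang together at
    [v]. *)
Lemma conn_setD_component D v x : conn D -> v \in D -> x \in D :\ v ->
  conn (D :\: component (D :\ v) x).
Proof.
move=> cD vD xDv; set E := component _ x.
have vE : v \notin E.
  by apply/negP => /(component_in xDv); rewrite !inE eqxx.
apply: (conn_root (x := v)); first by rewrite inE vE.
move=> y; rewrite inE => /andP[yE yD].
have [->|nyv] := eqVneq y v; first exact: connect0.
have yDv : y \in D :\ v by rewrite !inE nyv.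
have [z zC evz] := component_cut cD vD yDv.
have sC : component (D :\ v) y \subset D :\: E.
  apply/subsetP => t tC; rewrite inE; apply/andP; split.
    apply: contra yE => tE; rewrite /E -(component_eq tE) (component_eq tC).
    exact: component_refl.
  by have := component_in yDv tC; rewrite inE => /andP[].
have cCy := conn_component yDv.
apply: (connect_trans (y := z)).
  apply: connect1; rewrite inducedE evz inE vE vD.
  by rewrite (subsetP sC).
by apply: connect_inducedS sC _; apply: cCy.2 (component_refl _ _).
Qed.


(** * Attachment, excluded minors and the choice of a pivot vertex *)

Definition att (o : option V) A : Prop :=
  exists z a, [/\ o = Some z, a \in A & e z a].

Lemma att_sub (o : option V) A B : A \subset B -> att o A -> att o B.
Proof.
by move=> /subsetP sAB [z' [a [-> aA eza]]]; exists z', a; split=> //;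
  apply: sAB.
Qed.

Definition no_K4_minor : Prop := forall A1 A2 A3 A4,
  conn A1 -> conn A2 -> conn A3 -> conn A4 ->
  [disjoint A1 & A2] -> [disjoint A1 & A3] -> [disjoint A1 & A4] ->
  [disjoint A2 & A3] -> [disjoint A2 & A4] -> [disjoint A3 & A4] ->
  linked A1 A2 -> linked A1 A3 -> linked A1 A4 ->
  linked A2 A3 -> linked A2 A4 -> linked A3 A4 -> False.

Definition no_K23_minor : Prop := forall A B M1 M2 M3,
  conn A -> conn B -> conn M1 -> conn M2 -> conn M3 ->
  [disjoint A & B] -> [disjoint A & M1] -> [disjoint A & M2] ->
  [disjoint A & M3] -> [disjoint B & M1] -> [disjoint B & M2] ->
  [disjoint B & M3] -> [disjoint M1 & M2] -> [disjoint M1 & M3] ->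
  [disjoint M2 & M3] ->
  linked A M1 -> linked A M2 -> linked A M3 ->
  linked B M1 -> linked B M2 -> linked B M3 -> False.

Lemma disjointP2 A B : (forall x, x \in A -> x \in B -> False) ->
  [disjoint A & B].
Proof.
move=> H; apply/pred0P => x /=; apply/negP => /andP[xA xB].
exact: H xA xB.
Qed.

Lemma disjoint_mem A B x : [disjoint A & B] -> x \in A -> x \in B -> False.
Proof. by move=> /pred0P /(_ x) /= H xA xB; rewrite xA xB in H. Qed.

Lemma components_disjoint A x y : y \notin component A x ->
  [disjoint component A x & component A y].
Proof.
move=> yC; apply: disjointP2 => z zx zy; case/negP: yC.
by rewrite -(component_eq zx) (component_eq zy) component_refl.
Qed.

(* The pivot next to [u] in a component [D] attached to [u] only: among all
   pairs made of a neighbour [v] of [u] and a component of [D :\ v] attached to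
   [u], take one with the component as large as possible. *)
Lemma pivot_single u D : conn D -> att (Some u) D ->
  exists v, [/\ v \in D, e u v & forall x y, x \in D :\ v -> y \in D :\ v ->
    att (Some u) (component (D :\ v) x) ->
    att (Some u) (component (D :\ v) y) -> y \in component (D :\ v) x].
Proof.
move=> cD [_ [v0 [[<-] v0D euv0]]].
pose good := [pred p : V * V | [&& p.1 \in D, e u p.1, p.2 \in D :\ p.1 &
  [exists a in component (D :\ p.1) p.2, e u a]]].
have goodP v x : v \in D -> e u v -> x \in D :\ v ->
    att (Some u) (component (D :\ v) x) -> good (v, x).
  move=> vD euv xDv [_ [a [[<-] aC eua]]]; rewrite /= vD euv xDv /=.
  by apply/existsP; exists a; rewrite aC.
have [p0 gp0|nogood] := pickP good; last first.
  exists v0; split=> // x y xD yD ax _.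
  by have := goodP _ _ v0D euv0 xD ax; rewrite nogood.
have [[v x] /= /and4P[vD euv xDv /existsP[a /andP[aC eua]]] maxv] :=
  arg_maxnP (fun p => #|component (D :\ p.1) p.2|) gp0.
exists v; split=> // y z yD zD ay az.
have all_x t : t \in D :\ v -> att (Some u) (component (D :\ v) t) ->
    t \in component (D :\ v) x.
  move=> tD [_ [v' [[<-] v'C euv']]]; apply/negPn/negP => tC.
  have v'Dv := component_in tD v'C.
  have [nv'v v'D] : v' != v /\ v' \in D by case/setD1P: v'Dv.
  set X := component (D :\ v) x in aC tC maxv.
  have v'X : v' \notin X.
    apply: contra tC => v'X.
    by rewrite /X -(component_eq v'X) (component_eq v'C) component_refl.
  have cX : conn (v |: X).
    apply: connU (conn1 v) (conn_component xDv) _.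
    have [b bC evb] := component_cut cD vD xDv.
    by exists v, b; rewrite set11.
  have sX : v |: X \subset D :\ v'.
    rewrite subUset sub1set !inE eq_sym nv'v vD /=; apply/subsetP => b bX.
    rewrite !inE; have := component_in xDv bX; rewrite !inE => /andP[_ ->].
    by rewrite andbT; apply: contraNneq v'X => <-.
  have xX : x \in v |: X by rewrite inE component_refl orbT.
  have sC := component_max cX sX xX.
  have g' : good (v', x).
    apply: goodP => //; first by rewrite (subsetP sX).
    by exists u, a; split=> //; rewrite (subsetP sC) // inE aC orbT.
  have := maxv _ g'; rewrite leqNgt => /negP[].
  apply: leq_trans (subset_leq_card sC); rewrite cardsU1.
  suff -> : v \notin X by [].
  by apply/negP => /(component_in xDv); rewrite !inE eqxx.
by rewrite (component_eq (all_x _ yD ay)); apply: all_x.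
Qed.

Section Pivot.
Hypotheses (K4 : no_K4_minor) (K23 : no_K23_minor).
Variables (u w : V) (D B : {set V}).
Hypotheses (cD : conn D) (cB : conn B) (dBD : [disjoint B & D]).
Hypotheses (uB : u \in B) (wB : w \in B) (nuw : u != w).
Hypotheses (auD : att (Some u) D) (awD : att (Some w) D).

(** The branch set standing for [w] in all the minors below: it is connected, avoids [D] and is
    adjacent to [u], so that [B] acts as an edge from [u] to [w] outside [D]. *)
Let Bw := component (B :\ u) w.

Let wBu : w \in B :\ u.
Proof. by rewrite !inE eq_sym nuw wB. Qed.

Let wBw : w \in Bw.
Proof. exact: component_refl. Qed.

Let cBw : conn Bw.
Proof. exact: conn_component. Qed.

Let adj_u_Bw : linked [set u] Bw.
Proof.
by have [b bBw eub] := component_cut cB uB wBu; exists u, b; rewrite set11.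
Qed.

Let sBwB : {subset Bw <= B}.
Proof. by move=> b /(component_in wBu) /setD1P[]. Qed.

Let uBw : u \notin Bw.
Proof. by apply/negP => /(component_in wBu); rewrite !inE eqxx. Qed.

Let notD b : b \in B -> b \in D -> False.
Proof. exact: disjoint_mem dBD. Qed.

Let dis_u A : A \subset D -> [disjoint [set u] & A].
Proof.
by move=> /subsetP sA; apply: disjointP2 => x /set1P-> /sA; apply: notD.
Qed.

Let dis_Bw A : A \subset D -> [disjoint Bw & A].
Proof.
by move=> /subsetP sA; apply: disjointP2 => x /sBwB xB /sA; apply: notD.
Qed.

Let dis_u_Bw : [disjoint [set u] & Bw].
Proof. by apply: disjointP2 => x /set1P->; apply/negP. Qed.

Let adj_u A : att (Some u) A -> linked [set u] A.
Proof. by move=> [_ [a [[<-] aA eua]]]; exists u, a; rewrite set11. Qed.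

Let adj_w A : att (Some w) A -> linked Bw A.
Proof. by move=> [_ [a [[<-] aA eua]]]; exists w, a. Qed.

Let comp_sub v x : x \in D :\ v -> component (D :\ v) x \subset D.
Proof. by move=> xD; apply: subset_trans (component_sub xD) (subD1set D v). Qed.

Let v_notin v x : x \in D :\ v -> v \notin component (D :\ v) x.
Proof. by move=> xD; apply/negP => /(component_in xD); rewrite !inE eqxx. Qed.

Let adj_v v x : v \in D -> x \in D :\ v ->
  linked [set v] (component (D :\ v) x).
Proof.
move=> vD xD; have [y yC evy] := component_cut cD vD xD.
by exists v, y; rewrite set11.
Qed.

(** Otherwise [u], [Bw], the component and its complement in [D] are the branch sets of a K4. The
    complement contains [v], hence it is adjacent to [u] and to the component. *)
Let complement_not_att_w v x : v \in D -> e u v -> x \in D :\ v ->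
  att (Some u) (component (D :\ v) x) -> att (Some w) (component (D :\ v) x) ->
  att (Some w) (D :\: component (D :\ v) x) -> False.
Proof.
move=> vD euv xD au aw aw'; set E := component _ _ in au aw aw'.
have sE : E \subset D := comp_sub xD.
have vP : v \in D :\: E by rewrite inE vD v_notin.
apply: (K4 (A1 := [set u]) (A2 := Bw) (A3 := E) (A4 := D :\: E)).
- exact: conn1.
- exact: cBw.
- exact: conn_component.
- exact: conn_setD_component.
- exact: dis_u_Bw.
- exact: dis_u.
- by apply: dis_u; apply: subsetDl.
- exact: dis_Bw.
- by apply: dis_Bw; apply: subsetDl.
- by apply: disjointP2 => y yE; rewrite inE yE.
- exact: adj_u_Bw.
- exact: adj_u.
- by apply: adj_u; exists u, v.
- exact: adj_w.
- exact: adj_w.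
- by apply: linkedC; apply: linked_sub (adj_v vD xD) => //; rewrite sub1set.
Qed.

(** If every neighbour of [u] in [D] left a component attached to both ends, take such a pair [v],
    [E] with [E] smallest, a neighbour [v'] of [u] in [E], and a component [E'] for [v']. By K4 all
    neighbours of [w] in [D] lie in [E] and in [E']; by minimality [v] lies in [E'], so the
    complements [P] and [P'] are disjoint. Then [P], [P'] and [Bw] join [u] to a part of [E :&: E'],
    which is a K23. *)
Lemma pivot_separates : exists v, [/\ v \in D, e u v &
  forall x, x \in D :\ v -> att (Some u) (component (D :\ v) x) ->
    att (Some w) (component (D :\ v) x) -> False].
Proof.
pose bi (v x : V) := [&& x \in D :\ v,
  [exists a in component (D :\ v) x, e u a] &
  [exists a in component (D :\ v) x, e w a]].
have biP v x : reflect [/\ x \in D :\ v, att (Some u) (component (D :\ v) x) &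
    att (Some w) (component (D :\ v) x)] (bi v x).
  apply: (iffP and3P) => [[xD]|[xD [_ [a [[<-] aC ea]]] [_ [b [[<-] bC eb]]]]].
    move=> /existsP[a /andP[aC ea]] /existsP[b /andP[bC eb]].
    by split=> //; [exists u, a | exists w, b].
  by split=> //; apply/existsP; [exists a; rewrite aC | exists b; rewrite bC].
have [v /andP[/andP[vD euv] /forallP nobi]|allbi] :=
    pickP [pred v | (v \in D) && e u v && [forall x, ~~ bi v x]].
  exists v; split=> // x xD au aw; have /negP := nobi x; apply.
  exact/biP.
have exbi v : v \in D -> e u v -> exists x, bi v x.
  move=> vD euv; have := allbi v; rewrite /= vD euv /= => /negbT.
  by rewrite negb_forall => /existsP[x]; rewrite negbK; exists x.
pose good := [pred p : V * V | [&& p.1 \in D, e u p.1 & bi p.1 p.2]].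
have [_ [v0 [[<-] v0D euv0]]] := auD.
have [x0 bi0] := exbi _ v0D euv0.
have gp0 : good (v0, x0) by rewrite /= v0D euv0.
have [[v x] /= /and3P[vD euv /biP[xDv au aw]] minv] :=
  arg_minnP (fun p => #|component (D :\ p.1) p.2|) gp0.
set E := component (D :\ v) x in au aw minv.
have [_ [v' [[<-] v'E euv']]] := au.
have sED : {subset E <= D} by apply/subsetP/comp_sub.
have v'D := sED _ v'E.
have [x' bi'] := exbi _ v'D euv'.
have := bi' => /biP[x'D au' aw']; set E' := component (D :\ v') x' in au' aw'.
have sED' : {subset E' <= D} by apply/subsetP/comp_sub.
have nv : v \notin E by apply: v_notin.
have nv' : v' \notin E' by apply: v_notin.
have cE : conn E by apply: conn_component.
have cE' : conn E' by apply: conn_component.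
have W_E m : m \in D -> e w m -> m \in E.
  move=> mD ewm; apply/negPn/negP => mE.
  by apply: (complement_not_att_w vD euv xDv) => //; exists w, m;
    rewrite inE mE.
have W_E' m : m \in D -> e w m -> m \in E'.
  move=> mD ewm; apply/negPn/negP => mE.
  apply: (complement_not_att_w v'D euv' x'D) => //.
  by exists w, m; rewrite inE mE.
have [_ [m [[<-] mD ewm]]] := awD.
have mE := W_E _ mD ewm; have mE' := W_E' _ mD ewm.
have vE' : v \in E'.
  apply/negPn/negP => vE'.
  have sE'E : E' \subset E.
    rewrite /E -(component_eq mE); apply: component_max => //.
    apply/subsetP => b bE'; rewrite !inE sED' // andbT.
    by apply: contraNneq vE' => <-.
  have g' : good (v', x') by rewrite /= v'D euv'.
  have := minv _ g'; rewrite leqNgt => /negP[].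
  apply: proper_card; apply/properP; split=> //.
  by exists v'.
pose P := D :\: E; pose P' := D :\: E'.
have cP : conn P by apply: conn_setD_component.
have cP' : conn P' by apply: conn_setD_component.
have vP : v \in P by rewrite inE nv vD.
have v'P' : v' \in P' by rewrite inE nv' v'D.
have sPE' : {subset P <= E'}.
  apply/subsetP; rewrite /E' -(component_eq vE').
  apply: component_max cP _ vP; apply/subsetP => b.
  move=> /setDP[bD bE]; rewrite !inE bD andbT.
  by apply: contraNneq bE => ->.
(* The intersection may be disconnected; the part with the neighbour [m] of [w] is kept. A path in
   [E'] from [m] to [v] leaves [M] at a point outside [E], that is in [P]; the same holds with the
   roles exchanged. *)
pose M := component (E :&: E') m.
have mEE : m \in E :&: E' by rewrite inE mE mE'.
have sM : {subset M <= E :&: E'} by apply/subsetP/component_sub.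
have mM : m \in M by apply: component_refl.
have adjM_P : linked M P.
  have vM : v \notin M by apply: contra nv => /sM; rewrite inE => /andP[].
  have [a [b [_ aM bE' bM eab]]] := conn_exit cE' mE' mM vE' vM.
  exists a, b; split=> //; rewrite inE sED' // andbT.
  by apply: contra bM => bE; apply: component_step eab; rewrite // inE bE.
have adjM_P' : linked M P'.
  have v'M : v' \notin M by apply: contra nv' => /sM; rewrite inE => /andP[].
  have [a [b [_ aM bE bM eab]]] := conn_exit cE mE mM v'E v'M.
  exists a, b; split=> //; rewrite inE sED // andbT.
  by apply: contra bM => bE'; apply: component_step eab; rewrite // inE bE.
have sMD : M \subset D.
  by apply/subsetP => b /sM; rewrite inE => /andP[/sED].
exfalso; apply: (K23 (A := [set u]) (B := M) (M1 := P) (M2 := P') (M3 := Bw)).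
- exact: conn1.
- exact: conn_component.
- exact: cP.
- exact: cP'.
- exact: cBw.
- exact: dis_u.
- by apply: dis_u; apply: subsetDl.
- by apply: dis_u; apply: subsetDl.
- exact: dis_u_Bw.
- by apply: disjointP2 => b /sM/setIP[bE _] /setDP[_ /negP].
- by apply: disjointP2 => b /sM/setIP[_ bE'] /setDP[_ /negP].
- by rewrite disjoint_sym; apply: dis_Bw.
- by apply: disjointP2 => b /sPE' bE'; rewrite inE bE'.
- by rewrite disjoint_sym; apply: dis_Bw; apply: subsetDl.
- by rewrite disjoint_sym; apply: dis_Bw; apply: subsetDl.
- by apply: adj_u; exists u, v.
- by apply: adj_u; exists u, v'.
- exact: adj_u_Bw.
- exact: adjM_P.
- exact: adjM_P'.
- by apply: linkedC; apply: adj_w; exists w, m.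
Qed.

(** The pivot of [pivot_separates] already has both uniqueness properties, by K23. Two components
    attached to [u], with a third connection, would join [u] to [v]; two components attached to [w],
    with [u] itself, would join [v] to [Bw]. *)
Lemma pivot_double : exists v, [/\ v \in D, e u v,
  forall x, x \in D :\ v -> att (Some u) (component (D :\ v) x) ->
    att (Some w) (component (D :\ v) x) -> False,
  forall x y, x \in D :\ v -> y \in D :\ v ->
    att (Some u) (component (D :\ v) x) ->
    att (Some u) (component (D :\ v) y) -> y \in component (D :\ v) x &
  forall x y, x \in D :\ v -> y \in D :\ v ->
    att (Some w) (component (D :\ v) x) ->
    att (Some w) (component (D :\ v) y) -> y \in component (D :\ v) x].
Proof.
have [v [vD euv nobi]] := pivot_separates.
have dv y : y \in D :\ v -> [disjoint [set v] & component (D :\ v) y].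
  by move=> yD; apply: disjointP2 => b /set1P->; apply/negP/v_notin.
have duv : [disjoint [set u] & [set v]] by apply: dis_u; rewrite sub1set.
exists v; split=> // x y xD yD ax ay; apply/negPn/negP => yx.
(* [M3] leads from [u] to [v] around the two components: [Bw] alone if the neighbour [m] of [w] is
   [v], and otherwise [Bw] with the component of [m]. That component is attached to [w], so it is
   not attached to [u]. *)
- have [M3 [cM3 aM3 avM3 dM3]] : exists M3, [/\ conn M3, linked [set u] M3,
      linked [set v] M3 & forall A, [disjoint Bw & A] ->
        (forall m, m \in D :\ v -> att (Some w) (component (D :\ v) m) ->
           [disjoint component (D :\ v) m & A]) -> [disjoint M3 & A]].
    have [_ [m [[<-] mD ewm]]] := awD.
    have [mv|nmv] := eqVneq m v.
      exists Bw; split=> //; apply: linkedC; apply: adj_w.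
      by exists w, m; rewrite -mv set11.
    have mDv : m \in D :\ v by rewrite !inE nmv.
    have am : att (Some w) (component (D :\ v) m).
      by exists w, m; rewrite component_refl.
    exists (Bw :|: component (D :\ v) m); split.
    - by apply: connU => //; [apply: conn_component | apply: adj_w].
    - by apply: linked_sub adj_u_Bw => //; apply: subsetUl.
    - by apply: linked_sub (adj_v vD mDv) => //; apply: subsetUr.
    - move=> A dA dm; apply: disjointP2 => b; rewrite inE => /orP[].
        exact: disjoint_mem dA.
      exact: disjoint_mem (dm _ mDv am).
  have dM3c z : z \in D :\ v -> att (Some u) (component (D :\ v) z) ->
      [disjoint component (D :\ v) z & M3].
    move=> zD az; rewrite disjoint_sym; apply: dM3.
      by apply: dis_Bw; apply: comp_sub.
    move=> m mD am; apply: components_disjoint; apply/negP => zm.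
    by apply: (nobi z) => //; rewrite (component_eq zm).
  apply: (K23 (A := [set u]) (B := [set v]) (M1 := component (D :\ v) x)
    (M2 := component (D :\ v) y) (M3 := M3)) => //.
  + exact: conn1.
  + exact: conn1.
  + exact: conn_component.
  + exact: conn_component.
  + by apply: dis_u; apply: comp_sub.
  + by apply: dis_u; apply: comp_sub.
  + rewrite disjoint_sym; apply: dM3; first by rewrite disjoint_sym.
    by move=> m mD am; rewrite disjoint_sym; apply: dis_u; apply: comp_sub.
  + exact: dv.
  + exact: dv.
  + rewrite disjoint_sym; apply: dM3; last first.
      by move=> m mD _; rewrite disjoint_sym; apply: dv.
    by apply: dis_Bw; rewrite sub1set.
  + exact: components_disjoint.
  + exact: dM3c.
  + exact: dM3c.
  + exact: adj_u.
  + exact: adj_u.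
  + exact: adj_v.
  + exact: adj_v.
- apply: (K23 (A := [set v]) (B := Bw) (M1 := component (D :\ v) x)
    (M2 := component (D :\ v) y) (M3 := [set u])) => //.
  + exact: conn1.
  + exact: conn_component.
  + exact: conn_component.
  + exact: conn1.
  + by rewrite disjoint_sym; apply: dis_Bw; rewrite sub1set.
  + exact: dv.
  + exact: dv.
  + by rewrite disjoint_sym.
  + by apply: dis_Bw; apply: comp_sub.
  + by apply: dis_Bw; apply: comp_sub.
  + by rewrite disjoint_sym.
  + exact: components_disjoint.
  + by rewrite disjoint_sym; apply: dis_u; apply: comp_sub.
  + by rewrite disjoint_sym; apply: dis_u; apply: comp_sub.
  + exact: adj_v.
  + exact: adj_v.
  + by exists v, u; rewrite !set11 e_sym.
  + exact: adj_w.
  + exact: adj_w.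
  + exact: linkedC.
Qed.

End Pivot.

(* [o1] and [o2] are the ends of an interval of the Farey tree in which the
   vertices of [C] remain to be placed; [None] is an end without a vertex. *)
Record piece (o1 o2 : option V) C : Prop := Piece {
  piece_left : forall u, o1 = Some u -> u \notin C;
  piece_right : forall w, o2 = Some w -> w \notin C;
  piece_neq : forall u w, o1 = Some u -> o2 = Some w -> u != w;
  piece_closed : forall x y, x \in C -> e x y ->
    [\/ y \in C, o1 = Some y | o2 = Some y];
  piece_both : forall w x, o2 = Some w -> x \in C -> e w x ->
    att o1 (component C x);
  piece_unique : forall w x y, o2 = Some w -> x \in C -> y \in C ->
    e w x -> e w y -> y \in component C x;
  piece_link : forall u w x, o1 = Some u -> o2 = Some w -> x \in C -> e w x ->
    exists B, [/\ conn B, u \in B, w \in B & [disjoint B & C]]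
}.

(* The vertex with address [a] is the mediant of an interval of the Farey tree
   whose ends are its two (at most) neighbours of smaller depth. *)
Definition farey_adj (b a : seq bool) : Prop :=
  exists n, a = b ++ true :: nseq n false \/ a = b ++ false :: nseq n true.

Lemma farey_adj_cons t b a : farey_adj b a -> farey_adj (t :: b) (t :: a).
Proof. by move=> [n [->|->]]; exists n; [left | right]. Qed.

Definition farey_placing (o1 o2 : option V) C (addr : V -> seq bool) : Prop :=
  [/\ {in C &, injective addr},
      {in C &, forall x y, e x y ->
         farey_adj (addr x) (addr y) \/ farey_adj (addr y) (addr x)},
      forall u x, o1 = Some u -> x \in C -> e u x ->
        exists n, addr x = nseq n false &
      forall w x, o2 = Some w -> x \in C -> e w x ->
        exists n, addr x = nseq n true].

(** * Recursive placement in the Farey tree *)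

(** Neighbours of the left end need addresses made of [false] only, so none of them may lie in [M];
    symmetrically none of the right end may lie in [L]. *)
Lemma farey_placing_split o1 o2 C v L M addrL addrM :
  v \in C -> C = v |: (L :|: M) -> v \notin L -> v \notin M ->
  [disjoint L & M] ->
  (forall x y, x \in L -> y \in M -> e x y -> False) ->
  (forall u x, o1 = Some u -> x \in M -> e u x -> False) ->
  (forall w x, o2 = Some w -> x \in L -> e w x -> False) ->
  farey_placing o1 (Some v) L addrL -> farey_placing (Some v) o2 M addrM ->
  exists addr, farey_placing o1 o2 C addr.
Proof.
move=> vC defC vL vM dLM noLM noM noL [injL adjL uL vLr] [injM adjM vMl wM].
pose addr x := if x == v then [::] else
  if x \in L then false :: addrL x else true :: addrM x.
have av : addr v = [::] by rewrite /addr eqxx.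
have aL x : x \in L -> addr x = false :: addrL x.
  by move=> xL; rewrite /addr xL; case: eqP => // xv; rewrite -xv xL in vL.
have aM x : x \in M -> addr x = true :: addrM x.
  move=> xM; rewrite /addr; case: eqP => [xv|_]; first by rewrite -xv xM in vM.
  by case: ifP => // xL; have := disjoint_mem dLM xL xM.
have cases x : x \in C -> [\/ x = v, x \in L | x \in M].
  rewrite defC !inE => /orP[/eqP->|/orP[]]; first by constructor 1.
    by constructor 2.
  by constructor 3.
have adj_vL x : x \in L -> e v x -> farey_adj [::] (false :: addrL x).
  by move=> xL evx; have [n ->] := vLr _ _ erefl xL evx; exists n; right.
have adj_vM x : x \in M -> e v x -> farey_adj [::] (true :: addrM x).
  by move=> xM evx; have [n ->] := vMl _ _ erefl xM evx; exists n; left.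
exists addr; split.
- move=> x y /cases[->|xL|xM] /cases[->|yL|yM];
    rewrite ?av; try rewrite (aL _ xL); try rewrite (aL _ yL);
    try rewrite (aM _ xM); try rewrite (aM _ yM); move=> // -[].
    by apply: injL.
  by apply: injM.
- move=> x y /cases[->|xL|xM] /cases[->|yL|yM];
    rewrite ?av; try rewrite (aL _ xL); try rewrite (aL _ yL);
    try rewrite (aM _ xM); try rewrite (aM _ yM); move=> exy.
  + by case/negP: vL; have := exy; rewrite e_irr.
  + by left; apply: adj_vL.
  + by left; apply: adj_vM.
  + by right; apply: adj_vL; rewrite // e_sym.
  + by case: (adjL _ _ xL yL exy) => H; [left | right]; apply: farey_adj_cons.
  + by case: (noLM x y).
  + by right; apply: adj_vM; rewrite // e_sym.
  + by case: (noLM y x); rewrite // e_sym.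
  + by case: (adjM _ _ xM yM exy) => H; [left | right]; apply: farey_adj_cons.
- move=> u x o1u /cases[->|xL|xM] eux; first by exists 0; rewrite av.
    by have [n def_a] := uL _ _ o1u xL eux; exists n.+1; rewrite aL // def_a.
  by case: (noM _ _ o1u xM eux).
- move=> w x o2w /cases[->|xL|xM] ewx; first by exists 0; rewrite av.
    by case: (noL _ _ o2w xL ewx).
  by have [n def_a] := wM _ _ o2w xM ewx; exists n.+1; rewrite aM // def_a.
Qed.

(** [L] receives the components of [D :\ v] attached to the left end and everything of [C] outside
    [D]; [M] receives the other components of [D :\ v]. All of these components are adjacent to [v],
    so the ones in [L] are attached to both ends of the new interval and the ones in [M] to its left
    end. This is why [piece] treats its two ends asymmetrically. *)
Lemma piece_split o1 o2 u C D v :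
  piece o1 o2 C -> o1 = Some u -> v \in C -> D = component C v -> e u v ->
  (forall w x, o2 = Some w -> x \in C -> e w x -> x \in D) ->
  (forall x, x \in D :\ v -> att o1 (component (D :\ v) x) ->
     att o2 (component (D :\ v) x) -> False) ->
  (forall x y, x \in D :\ v -> y \in D :\ v ->
     att o1 (component (D :\ v) x) -> att o1 (component (D :\ v) y) ->
     y \in component (D :\ v) x) ->
  (forall x y, x \in D :\ v -> y \in D :\ v ->
     att o2 (component (D :\ v) x) -> att o2 (component (D :\ v) y) ->
     y \in component (D :\ v) x) ->
  exists L M, [/\ piece o1 (Some v) L, piece (Some v) o2 M,
    C = v |: (L :|: M), v \notin L & v \notin M] /\
    [/\ [disjoint L & M],
      forall x y, x \in L -> y \in M -> e x y -> False,
      forall u x, o1 = Some u -> x \in M -> e u x -> False &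
      forall w x, o2 = Some w -> x \in L -> e w x -> False].
Proof.
move=> pC o1u vC defD euv WD nobi uniq1 uniq2.
have cD : conn D by rewrite defD; apply: conn_component.
have vD : v \in D by rewrite defD component_refl.
have sDC : {subset D <= C} by rewrite defD; apply/subsetP/component_sub.
have stepD x y : x \in D -> y \in C -> e x y -> y \in D.
  by rewrite defD => xD yC exy; apply: component_step xD yC exy.
pose c x := component (D :\ v) x.
pose a1 x := [exists a in c x, e u a].
have a1P x : reflect (att o1 (c x)) (a1 x).
  apply: (iffP existsP) => [[a /andP[aC ea]]|[z [a [o1z aC ea]]]].
    by exists u, a.
  by exists a; rewrite aC; move: o1z; rewrite o1u => -[->].
have cE x y : x \in D :\ v -> y \in D :\ v -> e x y -> c y = c x.
  move=> xD yD exy; apply: component_eq.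
  exact: component_step xD (component_refl _ _) yD exy.
have a1E x y : x \in D :\ v -> y \in D :\ v -> e x y -> a1 y = a1 x.
  by move=> xD yD exy; rewrite /a1 (cE _ _ xD yD exy).
have a1c x y : y \in c x -> a1 y = a1 x.
  by move=> yc; rewrite /a1 /c (component_eq yc).
pose L := (C :\: D) :|: [set x in D :\ v | a1 x].
pose M := [set x in D :\ v | ~~ a1 x].
have inL x : x \in L = (x \in C) && (x \notin D) || (x \in D :\ v) && a1 x.
  by rewrite /L in_setU in_setD in_set andbC.
have inM x : x \in M = (x \in D :\ v) && ~~ a1 x by rewrite /M in_set.
have sLC : L \subset C.
  apply/subsetP => x; rewrite inL => /orP[/andP[]//|/andP[xD _]].
  by apply: sDC; case/setD1P: xD.
have sMC : M \subset C.
  apply/subsetP => x; rewrite inM => /andP[xD _].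
  by apply: sDC; case/setD1P: xD.
have vL : v \notin L by rewrite inL vD !inE eqxx andbF.
have vM : v \notin M by rewrite inM !inE eqxx.
have dLM : [disjoint L & M].
  apply: disjointP2 => x; rewrite inL inM => /orP[/andP[_ xD]|/andP[_ ->]].
    by rewrite !inE (negPf xD) andbF.
  by rewrite andbF.
have cL x : x \in D :\ v -> a1 x -> c x \subset L.
  move=> xD ax; apply/subsetP => y yc; have yD := component_in xD yc.
  by rewrite inL yD (a1c _ _ yc) ax orbT.
have cM x : x \in D :\ v -> ~~ a1 x -> c x \subset M.
  move=> xD ax; apply/subsetP => y yc; have yD := component_in xD yc.
  by rewrite inM yD (a1c _ _ yc) ax.
have DvP x y : x \in D :\ v -> y \in C -> e x y -> y != v -> y \in D :\ v.
  move=> /setD1P[_ xD] yC exy nyv.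
  by rewrite in_setD1 nyv; apply: stepD xD yC exy.
have noM z x : o1 = Some z -> x \in M -> e z x -> False.
  move=> o1z; rewrite inM => /andP[xD /negP ax] ezx; apply/ax/a1P.
  by exists z, x; rewrite component_refl.
have noL z x : o2 = Some z -> x \in L -> e z x -> False.
  move=> o2z xL ezx; have xD := WD _ _ o2z (subsetP sLC _ xL) ezx.
  move: xL; rewrite inL xD andbF /= => /andP[xDv /a1P ax].
  by apply: (nobi x) => //; exists z, x; rewrite component_refl.
have LvD x : x \in L -> e v x -> x \in D :\ v /\ a1 x.
  move=> xL evx; have xD : x \in D by apply: stepD evx;
    rewrite // (subsetP sLC).
  by move: xL; rewrite inL xD andbF => /andP[].
exists L, M; split; split=> //.
- split.
  + by move=> z o1z; apply: contra (piece_left pC o1z); apply: (subsetP sLC).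
  + by move=> z [<-].
  + move=> z z' o1z [<-]; apply: contraNneq (piece_left pC o1z) => ->.
    exact: vC.
  + move=> x y xL exy; have [->|nyv] := eqVneq y v; first by constructor 3.
    have [yC|o1y|o2y] := piece_closed pC (subsetP sLC _ xL) exy.
    * constructor 1; move: xL; rewrite !inL => /orP[/andP[xC xD]|/andP[xD ax]].
        rewrite yC; apply/orP; left; apply: contra xD => yD.
        by apply: stepD yD xC _; rewrite e_sym.
      have yD := DvP _ _ xD yC exy nyv.
      by rewrite yD (a1E x) ?ax ?orbT.
    * by constructor 2.
    * by case: (noL _ _ o2y xL); rewrite e_sym.
  + move=> z x [<-] xL evx; have [xD ax] := LvD _ xL evx.
    apply: att_sub (elimT (a1P x) ax).
    exact: component_max (conn_component xD) (cL _ xD ax) (component_refl _ _).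
  + move=> z x y [<-] xL yL evx evy.
    have [xD ax] := LvD _ xL evx; have [yD ay] := LvD _ yL evy.
    have sub := component_max (conn_component xD) (cL _ xD ax)
      (component_refl _ _).
    by apply: (subsetP sub); apply: uniq1 => //; apply/a1P.
  + move=> z z' x o1z [<-] _ _; exists [set u; v]; split.
    * exact: conn_pair.
    * by move: o1z; rewrite o1u => -[->]; rewrite set21.
    * by rewrite set22.
    * apply: disjointP2 => y /set2P[->|->]; last exact/negP.
      by move=> /(subsetP sLC); apply/negP; apply: (piece_left pC o1u).
- split.
  + by move=> z [<-].
  + by move=> z o2z; apply: contra (piece_right pC o2z); apply: (subsetP sMC).
  + move=> z z' [<-] o2z; apply: contraNneq (piece_right pC o2z) => <-.
    exact: vC.
  + move=> x y xM exy; have [->|nyv] := eqVneq y v; first by constructor 2.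
    have [yC|o1y|o2y] := piece_closed pC (subsetP sMC _ xM) exy.
    * constructor 1; move: xM; rewrite !inM => /andP[xD ax].
      have yD := DvP _ _ xD yC exy nyv.
      by rewrite yD (a1E x) ?ax.
    * by case: (noM _ _ o1y xM); rewrite e_sym.
    * by constructor 3.
  + move=> z x o2z; rewrite inM => /andP[xD ax] ezx.
    have [y yc evy] := component_cut cD vD xD.
    exists v, y; split=> //; apply: (subsetP _ _ yc).
    exact: component_max (conn_component xD) (cM _ xD ax) (component_refl _ _).
  + move=> z x y o2z; rewrite !inM => /andP[xD ax] /andP[yD ay] ezx ezy.
    have sub := component_max (conn_component xD) (cM _ xD ax)
      (component_refl _ _).
    apply: (subsetP sub); apply: uniq2 => //.
      by exists z, x; rewrite component_refl.
    by exists z, y; rewrite component_refl.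
  + move=> z z' x [<-] o2z xM ezx.
    have xC := subsetP sMC _ xM.
    have [B [cB uB zB dBC]] := piece_link pC o1u o2z xC ezx.
    exists (B :|: [set v]); split.
    * by apply: connU cB (conn1 v) _; exists u, v; rewrite set11.
    * by rewrite !inE eqxx orbT.
    * by rewrite inE zB.
    * apply: disjointP2 => y /setUP[yB yM|/set1P->]; last exact/negP.
      exact: disjoint_mem dBC yB (subsetP sMC _ yM).
- apply/setP => x; rewrite in_setU1 in_setU inL inM in_setD1.
  have [->|nxv] /= := eqVneq x v; first exact: vC.
  have [/sDC->|] := boolP (x \in D); last by rewrite andbT !orbF.
  by rewrite andbF /= orbN.
- move=> x y; rewrite inL inM => xL /andP[yD ay] exy.
  have yC : y \in C by apply: sDC; case/setD1P: yD.
  have yD' : y \in D by case/setD1P: yD.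
  case/orP: xL => [/andP[xC /negP[]]|/andP[xD ax]].
    by apply: stepD yD' xC _; rewrite e_sym.
  by rewrite (a1E x) // ax in ay.
Qed.

(** The mediant is given to a pivot next to the left end, taken in the component attached to the
    right end if there is one. If nothing is attached to the left end, then by [piece_both] nothing
    is attached to the right end either; any vertex may take the mediant, with all the others to its
    right. *)
Lemma farey_placing_exists : no_K4_minor -> no_K23_minor ->
  forall n C o1 o2, #|C| <= n -> piece o1 o2 C ->
  exists addr, farey_placing o1 o2 C addr.
Proof.
move=> K4 K23; elim=> [|n IH] C o1 o2 leCn pC.
  exists (fun=> [::]); move: leCn; rewrite leqn0 cards_eq0 => /eqP->.
  by split=> [x|x|u x _|w x _]; rewrite inE.
have [z zC|C0] := pickP (mem C); last first.
  exists (fun=> [::]).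
  by split=> [x y /=|x y /=|u x _|w x _] xC; have := C0 x; rewrite /= xC.
have small (A : {set V}) v : v \in C -> A \subset C -> v \notin A -> #|A| <= n.
  move=> vC sAC vA; rewrite -ltnS; apply: leq_trans leCn; apply: proper_card.
  by apply/properP; split=> //; exists v.
have finish v L M : v \in C -> C = v |: (L :|: M) -> v \notin L ->
    v \notin M -> [disjoint L & M] ->
    (forall x y, x \in L -> y \in M -> e x y -> False) ->
    (forall u x, o1 = Some u -> x \in M -> e u x -> False) ->
    (forall w x, o2 = Some w -> x \in L -> e w x -> False) ->
    piece o1 (Some v) L -> piece (Some v) o2 M ->
    exists addr, farey_placing o1 o2 C addr.
  move=> vC defC vL vM dLM h1 h2 h3 pL pM.
  have [aL fL] : exists addr, farey_placing o1 (Some v) L addr.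
    apply: IH pL; apply: small vC _ vL.
    by rewrite defC; apply/subsetP => x xL; rewrite !inE xL orbT.
  have [aM fM] : exists addr, farey_placing (Some v) o2 M addr.
    apply: IH pM; apply: small vC _ vM.
    by rewrite defC; apply/subsetP => x xL; rewrite !inE xL !orbT.
  exact: farey_placing_split vC defC vL vM dLM h1 h2 h3 fL fM.
have [[u [v [o1u vC euv]]]|noatt] : att o1 C \/ ~ att o1 C.
- case: o1 {pC finish} => [u|]; last by right=> -[u [v []]].
  have [/existsP[v /andP[vC euv]]|/negP H] := boolP [exists v in C, e u v].
    by left; exists u, v.
  right=> -[_ [v [[<-] vC euv]]]; apply: H.
  by apply/existsP; exists v; rewrite vC.
- suff [v' [v'C euv' [WD nobi un1 un2]]] : exists v', [/\ v' \in C, e u v' &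
      let D := component C v' in [/\
        forall w x, o2 = Some w -> x \in C -> e w x -> x \in D,
        forall x, x \in D :\ v' -> att o1 (component (D :\ v') x) ->
          att o2 (component (D :\ v') x) -> False,
        forall x y, x \in D :\ v' -> y \in D :\ v' ->
          att o1 (component (D :\ v') x) -> att o1 (component (D :\ v') y) ->
          y \in component (D :\ v') x &
        forall x y, x \in D :\ v' -> y \in D :\ v' ->
          att o2 (component (D :\ v') x) -> att o2 (component (D :\ v') y) ->
          y \in component (D :\ v') x]].
    have [L [M [[pL pM defC vL vM] [dLM h1 h2 h3]]]] :=
      piece_split pC o1u v'C erefl euv' WD nobi un1 un2.
    exact: (finish v' L M).
  have [[w [x [o2w xC ewx]]]|noatt2] : att o2 C \/ ~ att o2 C.
  + case: o2 {pC finish} => [w|]; last by right=> -[w [x []]].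
    have [/existsP[x /andP[xC ewx]]|/negP H] := boolP [exists x in C, e w x].
      by left; exists w, x.
    right=> -[_ [x [[<-] xC ewx]]]; apply: H.
    by apply/existsP; exists x; rewrite xC.
  + have [B [cB uB wB dBC]] := piece_link pC o1u o2w xC ewx.
    set D := component C x.
    have sDC : D \subset C by apply: component_sub.
    have dBD : [disjoint B & D].
      by apply: disjointP2 => y yB /(subsetP sDC); apply: disjoint_mem dBC yB.
    have auD : att (Some u) D by rewrite -o1u;
      apply: (piece_both pC o2w xC ewx).
    have awD : att (Some w) D by exists w, x; rewrite component_refl.
    have [v' [v'D euv' nobi un1 un2]] := pivot_double K4 K23
      (conn_component xC) cB dBD uB wB (piece_neq pC o1u o2w) auD awD.
    exists v'; have v'C := subsetP sDC _ v'D; split=> //.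
    rewrite /= (component_eq v'D) o1u o2w; split=> //.
    by move=> z' y [<-] yC ewy; apply: (piece_unique pC o2w xC yC ewx ewy).
  + have auD : att (Some u) (component C v).
      by exists u, v; rewrite component_refl.
    have [v' [v'D euv' un1]] := pivot_single (conn_component vC) auD.
    have v'C := component_in vC v'D.
    exists v'; split=> //; rewrite /= (component_eq v'D) o1u.
    have natt x : x \in component C v :\ v' ->
        att o2 (component (component C v :\ v') x) -> False.
      move=> xD a2; apply: noatt2; apply: att_sub a2.
      apply: subset_trans (component_sub xD) _.
      by apply: subset_trans (subD1set _ _) (component_sub vC).
    split=> //.
    * by move=> w x o2w xC ewx; case: noatt2; exists w, x.
    * by move=> x xD _; apply: natt.
    * by move=> x y xD _ a2; case: (natt x).
- have noatt2 w x : o2 = Some w -> x \in C -> e w x -> False.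
    move=> o2w xC ewx; apply: noatt; apply: att_sub (component_sub xC) _.
    exact: (piece_both pC o2w xC ewx).
  apply: (finish z set0 (C :\ z)) => //.
  + by rewrite set0U setD1K.
  + by rewrite inE.
  + by rewrite !inE eqxx.
  + by apply: disjointP2 => x; rewrite inE.
  + by move=> x y; rewrite inE.
  + by move=> u x o1u /setD1P[_ xC] eux; apply: noatt; exists u, x.
  + by move=> w x _; rewrite inE.
  + split=> //.
    * by move=> u _; rewrite inE.
    * by move=> w _; rewrite inE.
    * move=> u w o1u [<-]; apply: contraNneq (piece_left pC o1u) => ->.
      exact: zC.
    * by move=> x y; rewrite inE.
    * by move=> w x _; rewrite inE.
    * by move=> w x y _; rewrite inE.
    * by move=> u w x _ _; rewrite inE.
  + have sub : {subset C :\ z <= C} by move=> x /setD1P[].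
    split.
    * by move=> u [<-]; rewrite !inE eqxx.
    * move=> w o2w; apply: contra (piece_right pC o2w); exact: sub.
    * move=> u w [<-] o2w; apply: contraNneq (piece_right pC o2w) => <-.
      exact: zC.
    * move=> x y /setD1P[_ xC] exy; have [->|nyz] := eqVneq y z.
        by constructor 2.
      have [yC|o1y|o2y] := piece_closed pC xC exy.
      - by constructor 1; rewrite !inE nyz.
      - by case: noatt; exists y, x; rewrite e_sym.
      - by constructor 3.
    * by move=> w x o2w /sub xC ewx; case: (noatt2 _ _ o2w xC ewx).
    * by move=> w x y o2w /sub xC _ ewx; case: (noatt2 _ _ o2w xC ewx).
    * by move=> u w x _ o2w /sub xC ewx; case: (noatt2 _ _ o2w xC ewx).
Qed.

Lemma farey_embedding : no_K4_minor -> no_K23_minor ->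
  exists2 addr : V -> seq bool, injective addr &
    forall x y, e x y ->
      farey_adj (addr x) (addr y) \/ farey_adj (addr y) (addr x).
Proof.
move=> K4 K23.
have p0 : piece None None [set: V] by split=> // x y; rewrite inE;
  constructor 1.
have [addr [inj adj _ _]] := farey_placing_exists K4 K23 (leqnn _) p0.
by exists addr => [x y|x y exy]; [apply: inj | apply: adj]; rewrite ?inE.
Qed.

End GraphComponents.

(** * Nonplanarity of K33 and K5 *)

(* The relations are those of [winding_square] for the pairs of disjoint edges
   of a drawing of K33; each [na]/[nb] occurs twice in them, and each pair of
   points an even number of times, so only the signs contributed by the
   antisymmetry of the [h]s survive in the sum. *)
Lemma K33_parity (na nb : 'I_3 -> 'I_3 -> 'I_3 -> bool)
    (haa hab hba hbb : 'I_3 -> 'I_3 -> bool) :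
  (forall i i', i != i' -> haa i i' = xorb true (haa i' i)) ->
  (forall j j', j != j' -> hbb j j' = xorb true (hbb j' j)) ->
  (forall i j, hba j i = xorb true (hab i j)) ->
  (forall i j i' j', i != i' -> j != j' ->
     xorb (xorb (na i' i j) (nb j' i j)) (xorb (na i i' j') (nb j i' j')) =
     xorb (xorb (haa i' i) (hba j' i)) (xorb (hab i' j) (hbb j' j))) ->
  False.
Proof.
move=> Haa Hbb Hba H.
pose o0 : 'I_3 := @Ordinal 3 0 isT.
pose o1 : 'I_3 := @Ordinal 3 1 isT.
pose o2 : 'I_3 := @Ordinal 3 2 isT.
have G i j i' j' : i != i' -> j != j' -> xorb
     (xorb (xorb (na i' i j) (nb j' i j)) (xorb (na i i' j') (nb j i' j')))
     (xorb (xorb (haa i' i) (hba j' i)) (xorb (hab i' j) (hbb j' j))) = false.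
  by move=> ni nj; rewrite H // xorb_nilpotent.
pose add x y (Hx : x = false) (Hy : y = false) : xorb x y = false :=
  f_equal2 xorb Hx Hy.
have S i i' : i != i' -> _ := fun ni =>
  add _ _ (add _ _ (add _ _ (G i o0 i' o1 ni isT) (G i o1 i' o0 ni isT))
    (add _ _ (G i o0 i' o2 ni isT) (G i o2 i' o0 ni isT)))
    (add _ _ (G i o1 i' o2 ni isT) (G i o2 i' o1 ni isT)).
have := add _ _ (add _ _ (S o0 o1 isT) (S o0 o2 isT)) (S o1 o2 isT).
rewrite !Hba (Haa o1 o0) // (Haa o2 o0) // (Haa o2 o1) //.
rewrite (Hbb o1 o0) // (Hbb o2 o0) // (Hbb o2 o1) //.
move=> Z; suff : false = true by [].
rewrite -{1}Z; ring.
Qed.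

(** All 15 pairs of disjoint edges are summed. Each [n] occurs twice and each pair of points six
    times. The order of the arguments of [h] is reversed 4, 3 and 2 times in the three pairings of
    four indices, an odd number for each of the five quadruples, so the sum is [true]. *)
Lemma K5_parity (n : 'I_5 -> 'I_5 -> 'I_5 -> bool) (h : 'I_5 -> 'I_5 -> bool) :
  (forall i j, i != j -> h i j = xorb true (h j i)) ->
  (forall i j k l, uniq [:: i; j; k; l] ->
     xorb (xorb (n k i j) (n l i j)) (xorb (n i k l) (n j k l)) =
     xorb (xorb (h k i) (h l i)) (xorb (h k j) (h l j))) ->
  False.
Proof.
move=> Hh H.
pose o0 : 'I_5 := @Ordinal 5 0 isT.
pose o1 : 'I_5 := @Ordinal 5 1 isT.
pose o2 : 'I_5 := @Ordinal 5 2 isT.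
pose o3 : 'I_5 := @Ordinal 5 3 isT.
pose o4 : 'I_5 := @Ordinal 5 4 isT.
have G i j k l : uniq [:: i; j; k; l] -> xorb
     (xorb (xorb (n k i j) (n l i j)) (xorb (n i k l) (n j k l)))
     (xorb (xorb (h k i) (h l i)) (xorb (h k j) (h l j))) = false.
  by move=> u; rewrite H // xorb_nilpotent.
pose add x y (Hx : x = false) (Hy : y = false) : xorb x y = false :=
  f_equal2 xorb Hx Hy.
have := add _ _ (add _ _ (add _ _ (add _ _
  (add _ _ (add _ _ (G o0 o1 o2 o3 isT) (G o0 o2 o1 o3 isT))
           (G o0 o3 o1 o2 isT))
  (add _ _ (add _ _ (G o0 o1 o2 o4 isT) (G o0 o2 o1 o4 isT))
           (G o0 o4 o1 o2 isT)))
  (add _ _ (add _ _ (G o0 o1 o3 o4 isT) (G o0 o3 o1 o4 isT))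
           (G o0 o4 o1 o3 isT)))
  (add _ _ (add _ _ (G o0 o2 o3 o4 isT) (G o0 o3 o2 o4 isT))
           (G o0 o4 o2 o3 isT)))
  (add _ _ (add _ _ (G o1 o2 o3 o4 isT) (G o1 o3 o2 o4 isT))
           (G o1 o4 o2 o3 isT)).
rewrite (Hh o1 o0) // (Hh o2 o0) // (Hh o3 o0) // (Hh o4 o0) //.
rewrite (Hh o2 o1) // (Hh o3 o1) // (Hh o4 o1) //.
rewrite (Hh o3 o2) // (Hh o4 o2) // (Hh o4 o3) //.
move=> Z; suff : false = true by [].
rewrite -{1}Z; ring.
Qed.

From mathcomp Require Import all_order all_algebra.
From mathcomp Require Import complex.
From mathcomp Require Import all_classical all_reals all_analysis.
From mathcomp Require Import measurable_realfun.
From mathcomp Require Import lra.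

Import Order.TTheory GRing.Theory Num.Theory.
Import numFieldNormedType.Exports.

Local Open Scope classical_set_scope.
Local Open Scope ring_scope.

Lemma xorb_comb a b c d x y : a = b -> c = d ->
  xorb (xorb x y) (xorb (xorb a b) (xorb c d)) = false -> x = y.
Proof.
by move=> -> ->; rewrite !xorb_nilpotent xorb_false_r => /xorb_eq.
Qed.

(** * Crossings of a half-axis counted mod 2 *)

Section CrossingParity.
Variable R : realType.
Implicit Types (p q x y z : R * R) (s r : seq (R * R)).

(** The positive half-axis is included and the negative one is not, so that exactly one of [z] and
    [- z] is upper when [z] is nonzero. *)
Definition upper z : bool := (0 < z.2) || (z.2 == 0) && (0 < z.1).

(* Whether a short step from [z] to [z'] crosses the negative half-axis. *)
Definition cuts z z' : bool := xorb (upper z) (upper z') && (z.1 < 0).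

Lemma upperN z : z != 0 -> upper (- z) = xorb true (upper z).
Proof.
case: z => a b; rewrite /upper /= oppr_gt0 oppr_eq0.
move=> nz; have : (a != 0) || (b != 0).
  by apply: contraNT nz; rewrite negb_or !negbK => /andP[/eqP-> /eqP->].
by case: (ltrgt0P b) => //= _; rewrite orbF oppr_gt0; case: (ltrgt0P a).
Qed.

Lemma norm_prod_lt z e : (`|z| < e) = (`|z.1| < e) && (`|z.2| < e).
Proof. by rewrite prod_normE gt_max. Qed.

Lemma norm_prod_ge z e : (e <= `|z|) = (e <= `|z.1|) || (e <= `|z.2|).
Proof. by rewrite prod_normE le_max. Qed.

Section Small.
Variable d : R.
Hypothesis d0 : 0 < d.

Let far z := d <= `|z|.
Let near_ z z' := `|z - z'| < d / 2.

(** A short step that changes sides starts close to the horizontal axis. Being far from the origin,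
    [z] then has a first coordinate of size at least [d], whose sign a move below [d / 2] cannot
    change. *)
Lemma side_const z z' y : far z -> near_ z z' -> near_ z y ->
  upper z != upper z' -> (y.1 < 0) = (z.1 < 0) /\ z.1 != 0.
Proof.
case: z z' y => [a b] [a' b'] [u v].
rewrite /far /near_ norm_prod_ge !norm_prod_lt /= /upper /=.
move=> + /andP[_ nb] /andP[nu _] nup.
have bd : `|b| < d.
  rewrite ltr_norml; move: nb; rewrite ltr_norml => /andP[nb1 nb2].
  have := d0; move: nup.
  have [b0|b0|b0] := ltrgt0P b; have [b'0|b'0|b'0] := ltrgt0P b' => //=;
    by move=> _ dp; apply/andP; split; lra.
move=> /orP[|]; last by rewrite leNgt bd.
rewrite ler_normr; move: nu; rewrite ltr_norml => /andP[nu1 nu2].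
have := d0 => dp /orP[h|h].
  split; last by rewrite gt_eqF //; lra.
  by apply/idP/idP => hh; lra.
split; last by rewrite lt_eqF //; lra.
by apply/idP/idP => hh; lra.
Qed.

(** Either no corner changes sides, or by [side_const] all first coordinates have the same sign;
    [cuts] is then zero or the difference of [upper]. *)
Lemma cuts_square z00 z10 z01 z11 : far z00 -> far z10 -> far z01 -> far z11 ->
  near_ z00 z10 -> near_ z00 z01 -> near_ z00 z11 -> near_ z10 z01 ->
  near_ z10 z11 -> near_ z01 z11 ->
  xorb (cuts z00 z10) (cuts z01 z11) = xorb (cuts z00 z01) (cuts z10 z11).
Proof.
have nearC x y : near_ x y -> near_ y x by rewrite /near_ distrC.
move=> f00 f10 f01 f11 n1 n2 n3 n4 n5 n6.
have key x y : far x -> near_ x y -> upper x != upper y ->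
    near_ x z00 \/ x = z00 -> near_ x z10 \/ x = z10 ->
    near_ x z01 \/ x = z01 -> near_ x z11 \/ x = z11 ->
    exists b, [/\ (z00.1 < 0) = b, (z10.1 < 0) = b, (z01.1 < 0) = b &
      (z11.1 < 0) = b].
  move=> fx nxy uxy h1 h2 h3 h4; exists (x.1 < 0).
  have sc w : near_ x w \/ x = w -> (w.1 < 0) = (x.1 < 0).
    by move=> [nw|->] //; have [] := side_const fx nxy nw uxy.
  by split; apply: sc.
have fin b : [/\ (z00.1 < 0) = b, (z10.1 < 0) = b, (z01.1 < 0) = b &
      (z11.1 < 0) = b] -> 
  xorb (cuts z00 z10) (cuts z01 z11) = xorb (cuts z00 z01) (cuts z10 z11).
  rewrite /cuts => -[-> -> -> _]; case: b; rewrite ?andbF // !andbT.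
  by case: (upper z00); case: (upper z10); case: (upper z01); case: (upper z11).
have [e1|u1] := eqVneq (upper z00) (upper z10); last first.
  have [||||b /fin//] := key _ _ f00 n1 u1; by [right|left].
have [e2|u2] := eqVneq (upper z00) (upper z01); last first.
  have [||||b /fin//] := key _ _ f00 n2 u2; by [right|left].
have [e3|u3] := eqVneq (upper z00) (upper z11); last first.
  have [||||b /fin//] := key _ _ f00 n3 u3; by [right|left].
by rewrite /cuts -e1 -e2 -e3 xorb_nilpotent.
Qed.

(** [- z] crosses the negative half-axis when [z] crosses the positive one, and a change of [upper]
    is a crossing of one of the two. *)
Lemma cutsN z z' : far z -> far z' -> near_ z z' ->
  cuts (- z) (- z') = xorb (cuts z z') (xorb (upper z) (upper z')).
Proof.
move=> fz fz' nz.
have far_neq0 w : far w -> w != 0.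
  by move=> fw; rewrite -normr_gt0; apply: lt_le_trans fw.
have [e|u] := eqVneq (upper z) (upper z').
  by rewrite /cuts !upperN ?far_neq0 // e !xorb_nilpotent.
have [_ z0] := side_const fz nz nz u.
rewrite /cuts !upperN ?far_neq0 //= oppr_lt0.
move: u z0; case: (upper z); case: (upper z') => //= _;
  by case: (ltrgt0P z.1).
Qed.


(* Parity of the winding of the polygon [x :: s] around [p]. *)
Fixpoint winding p x s : bool :=
  if s is y :: s' then xorb (cuts (x - p) (y - p)) (winding p y s') else false.

Let sep x s y r := forall a b, a \in x :: s -> b \in y :: r -> far (a - b).
Let step : rel (R * R) := fun a b => `|a - b| < d / 4.

(** Summing [cuts_square] along the polygon cancels the inner terms. The polygon is open, so the
    terms of its two ends remain. *)
Lemma winding_step x s y y' :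
  path step x s -> step y y' -> sep x s y [:: y'] ->
  xorb (winding y x s) (winding y' x s) =
  xorb (cuts (x - y) (x - y')) (cuts (last x s - y) (last x s - y')).
Proof.
elim: s x => [|x' s IH] x /=; first by rewrite xorb_nilpotent.
move=> /andP[xx' ps] yy' sp.
have sp' : sep x' s y [:: y'].
  by move=> a b ax' by_; apply: sp => //; rewrite inE ax' orbT.
have st := IH x' ps yy' sp'.
have sq : xorb (cuts (x - y) (x' - y)) (cuts (x - y') (x' - y')) =
    xorb (cuts (x - y) (x - y')) (cuts (x' - y) (x' - y')).
  have subrB (a b a' b' : R * R) : (a - b) - (a' - b') = (a - a') - (b - b').
    by rewrite !opprB [b' - a']addrC addrACA [- b + b']addrC.
  (* One step of each chain, each below [d / 4], moves the difference by less than the [d / 2] of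
     [near_]. *)
  have near_add (u v : R * R) : `|u| < d / 4 -> `|v| < d / 4 -> `|u + v| < d /
    2.
    move=> u4 v4; apply: le_lt_trans (ler_normD _ _) _; lra.
  have near_half (u : R * R) : `|u| < d / 4 -> `|u| < d / 2.
    by move=> u4; have := d0; lra.
  have yy2 : `|y' - y| < d / 4 by rewrite distrC.
  have fa a b : a \in [:: x; x'] -> b \in [:: y; y'] -> far (a - b).
    by rewrite !inE => /orP[]/eqP-> hb; apply: sp; rewrite ?inE ?eqxx ?orbT.
  apply: cuts_square.
  - by apply: fa; rewrite !inE eqxx.
  - by apply: fa; rewrite !inE eqxx ?orbT.
  - by apply: fa; rewrite !inE eqxx ?orbT.
  - by apply: fa; rewrite !inE eqxx ?orbT.
  - by rewrite /near_ subrB; apply: near_half; rewrite subrr subr0.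
  - by rewrite /near_ subrB subrr sub0r opprB; apply: near_half.
  - by rewrite /near_ subrB opprB; apply: near_add.
  - rewrite /near_ subrB opprB; apply: near_add => //.
    by rewrite distrC.
  - by rewrite /near_ subrB subrr sub0r opprB; apply: near_half.
  - by rewrite /near_ subrB; apply: near_half; rewrite subrr subr0.
apply: (xorb_comb sq st); ring.
Qed.

(** The small squares in the grid of differences of the two chains sum to its four sides. Where the
    second chain moves, the difference has the wrong sign; [cutsN] turns these sides into windings
    of [y :: r], at the cost of the [upper] values at the corners. *)
Lemma winding_square x s y r : path step x s -> path step y r -> sep x s y r ->
  xorb (xorb (winding y x s) (winding (last y r) x s))
       (xorb (winding x y r) (winding (last x s) y r)) =
  xorb (xorb (upper (y - x)) (upper (last y r - x)))
       (xorb (upper (y - last x s)) (upper (last y r - last x s))).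
Proof.
elim: r y => [|y' r IH] y /=; first by rewrite !xorb_nilpotent.
move=> ps /andP[yy' pr] sp.
have sp' : sep x s y' r.
  by move=> a b ha hb; apply: sp => //; rewrite inE hb orbT.
have sp1 : sep x s y [:: y'].
  move=> a b ha; rewrite !inE => hb; apply: sp => //; rewrite !inE.
  by case/orP: hb => ->; rewrite ?orbT.
have st := winding_step ps yy' sp1.
have flip w : w \in x :: s -> cuts (w - y) (w - y') =
    xorb (cuts (y - w) (y' - w)) (xorb (upper (y - w)) (upper (y' - w))).
  move=> hw; rewrite -cutsN.
  - by rewrite !opprB.
  - by rewrite /far distrC; apply: sp; rewrite // inE eqxx.
  - by rewrite /far distrC; apply: sp; rewrite // !inE eqxx orbT.
  - rewrite /near_ opprB addrA subrK; move: yy'; rewrite /step => ?.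
    by have := d0; lra.
rewrite flip ?mem_head // flip ?mem_last // in st.
apply: (xorb_comb (IH y' ps pr sp') st); ring.
Qed.

End Small.
End CrossingParity.

(** * From connected compact sets to separated chains *)

Section Nonplanarity.
Variable R : realType.
Implicit Types (S A B : set (R * R)) (x y z p : R * R).

(** The points reached from [x] by such chains form a subset that is open and closed in [S]. *)
Lemma connected_chain S (eps : R) x y : 0 < eps -> connected S -> S x -> S y ->
  exists s : seq (R * R), [/\ path (fun a b => `|a - b| < eps) x s,
    last x s = y & forall a, a \in x :: s -> S a].
Proof.
move=> e0 cS Sx Sy.
pose B := [set z | exists s : seq (R * R),
  [/\ path (fun a b => `|a - b| < eps) x s,
      last x s = z & forall a, a \in x :: s -> S a]].
have BS z : B z -> S z by move=> [s [_ <- Ss]]; apply: Ss; apply: mem_last.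
have grow z z' : B z -> S z' -> `|z - z'| < eps -> B z'.
  move=> [s [ps lz Ss]] Sz' zz'; exists (rcons s z'); split.
  - by rewrite rcons_path ps lz.
  - by rewrite last_rcons.
  - by move=> a; rewrite -rcons_cons mem_rcons inE => /orP[/eqP->|/Ss].
have op (Q : set (R * R)) : open [set z | exists2 b, Q b & `|b - z| < eps].
  rewrite (_ : [set z | _] = \bigcup_(b in Q) ball b eps).
    by apply: bigcup_open => b _; apply: ball_open.
  by apply/seteqP; split=> z /= [b Qb bz]; exists b => //; move: bz;
    rewrite -ball_normE.
suff BeqS : B = S by have : B y by rewrite BeqS.
apply: cS.
- by exists x, [::]; split=> // a; rewrite inE => /eqP->.
- exists [set z | exists2 b, B b & `|b - z| < eps]; first exact: op.
  apply/seteqP; split=> z /=.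
    by move=> Bz; split; [exact: BS | exists z; rewrite ?subrr ?normr0].
  by move=> [Sz [b Bb bz]]; apply: grow bz.
- exists (~` [set z | exists2 b, (S `\` B) b & `|b - z| < eps]).
    exact/open_closedC/op.
  apply/seteqP; split=> z /=.
    move=> Bz; split; first exact: BS.
    by move=> [b [Sb nBb] bz]; apply: nBb; apply: grow Bz Sb _; rewrite distrC.
  move=> [Sz nz]; apply: contrapT => nBz; apply: nz.
  by exists z; rewrite ?subrr ?normr0.
Qed.

(** Stated for all small [d], so that finitely many pairs of sets get a common bound. *)
Lemma compact_separation A B : compact A -> compact B -> A `&` B = set0 ->
  \forall d \near (0 : R)^'+, forall a b, A a -> B b -> d <= `|a - b|.
Proof.
move=> cA cB AB0.
have clB : closed B by apply: compact_closed => //; exact: norm_hausdorff.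
suff : \forall d \near (0 : R)^'+,
    A `<=` [set a | forall b, B b -> d <= `|a - b|].
  by apply: filterS => d H a b Aa; apply: H.
move/compact_near_coveringP: cA; apply => x Ax.
have : nbhs x (~` B).
  apply: open_nbhs_nbhs; split; first exact: closed_openC.
  by move=> Bx; have : (A `&` B) x by []; rewrite AB0.
move/nbhs_ballP => [r /= r0 xr].
exists (ball x (r / 2), [set d | d < r / 2]) => /=.
  split; first by apply: nbhsx_ballx; rewrite divr_gt0.
  by apply: nbhs_right_lt; rewrite divr_gt0.
move=> [a d] /= [+ dr] b Bb; rewrite -ball_normE /= => xa.
have rb : r <= `|x - b|.
  rewrite leNgt; apply/negP => xb; apply: (xr b) => //.
  by rewrite -ball_normE.
have := ler_normD (x - a) (a - b); rewrite addrA subrK; lra.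
Qed.

Lemma separated_chains (I : finType) (x y : I -> R * R) (S : I -> set (R * R))
    (indep : rel I) :
  (forall i, compact (S i)) -> (forall i, connected (S i)) ->
  (forall i, S i (x i)) -> (forall i, S i (y i)) ->
  (forall i j, indep i j -> S i `&` S j = set0) ->
  exists d : R, 0 < d /\ exists s : I -> seq (R * R),
   [/\ forall i, path (fun a b => `|a - b| < d / 4) (x i) (s i),
       forall i, last (x i) (s i) = y i &
       forall i j, indep i j -> forall a b, a \in x i :: s i ->
         b \in x j :: s j -> d <= `|a - b|].
Proof.
move=> cS kS Sx Sy dS.
have [d [d0 sepd]] : exists d : R, 0 < d /\ forall i j, indep i j ->
    forall a b, S i a -> S j b -> d <= `|a - b|.
  have : \forall d \near (0 : R)^'+, forall ij : I * I, indep ij.1 ij.2 ->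
      forall a b, S ij.1 a -> S ij.2 b -> d <= `|a - b|.
    apply: filter_forall => -[i j] /=; have [ij|nij] := boolP (indep i j).
      have := compact_separation (cS i) (cS j) (dS _ _ ij).
      by apply: filterS => d H _.
    by near=> d.
  move=> H; near (0 : R)^'+ => d; exists d; split=> //.
  move=> i j; have : forall ij : I * I, indep ij.1 ij.2 ->
      forall a b, S ij.1 a -> S ij.2 b -> d <= `|a - b| by near: d.
  exact: (fun K => K (i, j)).
have d4 : 0 < d / 4 by rewrite divr_gt0.
have /choice[s sP] i := connected_chain d4 (kS i) (Sx i) (Sy i).
exists d; split=> //; exists s; split.
- by move=> i; have [] := sP i.
- by move=> i; have [] := sP i.
- move=> i j ij a b ai bj; apply: (sepd _ _ ij).
    by have [_ _] := sP i; apply.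
  by have [_ _] := sP j; apply.
Unshelve. all: by end_near. Qed.

Theorem K33_nonplanar (a b : 'I_3 -> R * R) (S : 'I_3 -> 'I_3 -> set (R * R)) :
  (forall i j, compact (S i j)) -> (forall i j, connected (S i j)) ->
  (forall i j, S i j (a i)) -> (forall i j, S i j (b j)) ->
  (forall i j i' j', i != i' -> j != j' -> S i j `&` S i' j' = set0) -> False.
Proof.
move=> cS kS Sa Sb dS.
pose indep (e f : 'I_3 * 'I_3) := (e.1 != f.1) && (e.2 != f.2).
have [|||||d [d0 [s [ps ls sep]]]] := @separated_chains ('I_3 * 'I_3)%type
    (fun e => a e.1) (fun e => b e.2) (fun e => S e.1 e.2) indep.
- by move=> [].
- by move=> [].
- by move=> [].
- by move=> [].
- by move=> [i j] [i' j'] /andP[]; apply: dS.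
have neq0 z : d <= `|z| -> z != 0.
  by move=> dz; rewrite -normr_gt0; apply: lt_le_trans dz.
(* Two points are known to be distinct once they are ends of two disjoint edges; the other ends of
   these edges are chosen with this. *)
have neq3 (i : 'I_3) : exists i' : 'I_3, i != i'.
  by exists (ordS i); case: i => [[|[|[|]]]].
have ends e f : indep e f -> forall x y, x \in [:: a e.1; b e.2] ->
    y \in [:: a f.1; b f.2] -> x - y != 0.
  have mem_ends g x : x \in [:: a g.1; b g.2] -> x \in a g.1 :: s g.
    by rewrite mem_seq2 => /orP[]/eqP->;
      [apply: mem_head | rewrite -ls mem_last].
  by move=> ef x y hx hy; apply: neq0; apply: (sep _ _ ef); apply: mem_ends.
apply: (@K33_parity (fun k i j => winding (a k) (a i) (s (i, j)))
  (fun k i j => winding (b k) (a i) (s (i, j)))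
  (fun i i' => upper (a i - a i')) (fun i j => upper (a i - b j))
  (fun j i => upper (b j - a i)) (fun j j' => upper (b j - b j'))).
- move=> i i' ii'; rewrite -opprB upperN //; have [j' jj'] := neq3 ord0.
  by apply: (@ends (i', ord0) (i, j')); rewrite ?inE ?eqxx //; apply/andP;
    rewrite eq_sym.
- move=> j j' jj'; rewrite -opprB upperN //; have [i' ii'] := neq3 ord0.
  by apply: (@ends (ord0, j') (i', j)); rewrite ?inE ?eqxx ?orbT //; apply/andP;
    rewrite [j' == _]eq_sym.
- move=> i j; rewrite -opprB upperN //.
  have [i' ii'] := neq3 i; have [j' jj'] := neq3 j.
  apply: (@ends (i, j') (i', j)); rewrite ?inE ?eqxx ?orbT //.
  by apply/andP; rewrite [j' == _]eq_sym.
- move=> i j i' j' ii' jj'.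
  have ij : indep (i, j) (i', j') by apply/andP.
  have := winding_square d0 (ps (i, j)) (ps (i', j')) (sep _ _ ij).
  by rewrite !ls.
Qed.

Theorem K5_nonplanar (a : 'I_5 -> R * R) (S : 'I_5 -> 'I_5 -> set (R * R)) :
  (forall i j, compact (S i j)) -> (forall i j, connected (S i j)) ->
  (forall i j, S i j (a i)) -> (forall i j, S i j (a j)) ->
  (forall i j k l, uniq [:: i; j; k; l] -> S i j `&` S k l = set0) -> False.
Proof.
move=> cS kS Sa Sb dS.
pose indep (e f : 'I_5 * 'I_5) := uniq [:: e.1; e.2; f.1; f.2].
have [|||||d [d0 [s [ps ls sep]]]] := @separated_chains ('I_5 * 'I_5)%type
    (fun e => a e.1) (fun e => a e.2) (fun e => S e.1 e.2) indep.
- by move=> [].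
- by move=> [].
- by move=> [].
- by move=> [].
- by move=> [i j] [i' j']; apply: dS.
apply: (@K5_parity (fun k i j => winding (a k) (a i) (s (i, j)))
  (fun i j => upper (a i - a j))).
- move=> i j ij; rewrite -opprB upperN // -normr_gt0.
  have [k [l u]] : exists k l, uniq [:: j; k; i; l].
    pose o n (n5 : (n < 5)%N) : 'I_5 := Ordinal n5.
    case: i j ij => [[|[|[|[|[|//]]]]] ?] [[|[|[|[|[|//]]]]] ?] // _;
      by [exists (o 2 isT), (o 3 isT) | exists (o 1 isT), (o 3 isT)
        | exists (o 1 isT), (o 2 isT) | exists (o 0 isT), (o 3 isT)
        | exists (o 0 isT), (o 2 isT) | exists (o 0 isT), (o 1 isT)].
  apply: lt_le_trans d0 _; apply: (sep (j, k) (i, l)) => //; exact: mem_head.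
- move=> i j k l u.
  have := winding_square d0 (ps (i, j)) (ps (k, l)) (sep (i, j) (k, l) u).
  by rewrite !ls.
Qed.

End Nonplanarity.

(** * Outerplanar graphs have no K4 and K23 minors *)

Section Continua.
Variable R : realType.
Local Notation plane := (R * R)%type.
Implicit Types (S K : set plane) (x y z : plane).

Definition continuum S : Prop := compact S /\ connected S.

Lemma continuum1 z : continuum [set z].
Proof. by split; [exact: compact_set1 | exact: connected1]. Qed.

Lemma finite_union_compact (I : finType) (K : I -> set plane) :
  (forall i, compact (K i)) -> compact [set z | exists i, K i z].
Proof.
move=> cK; apply/compact_near_coveringP => J F P FF H.
have : \forall j \near F, forall i, K i `<=` P j.
  apply: filter_forall => i; move/compact_near_coveringP: (cK i).
  by apply=> z Kz; apply: H; exists i.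
by apply: filterS => j Hj z [i Kz]; apply: Hj Kz.
Qed.

Lemma star_connected S x : S x ->
  (forall z, S z -> exists K, [/\ connected K, K `<=` S, K x & K z]) ->
  connected S.
Proof.
move=> Sx star.
pose D := [set K | [/\ connected K, K `<=` S & K x]].
rewrite (_ : S = \bigcup_(K in D) K).
  apply: bigcup_connected; first by exists x => K [].
  by move=> K [].
apply/seteqP; split=> z; last by move=> [K [_ KS _]]; apply: KS.
by move=> /star[K [cK KS Kx Kz]]; exists K.
Qed.

Lemma continuumU S K z : S z -> K z -> continuum S -> continuum K ->
  continuum (S `|` K).
Proof.
move=> Sz Kz [cS kS] [cK kK]; split; first exact: compactU.
by apply: connectedU => //; exists z.
Qed.

Definition plane_segment x y : set plane :=
  (fun t : R => x + t *: (y - x)) @` `[0, 1].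

Lemma plane_segmentL x y : plane_segment x y x.
Proof.
by exists 0; rewrite ?scale0r ?addr0 //= in_itv /= lexx ler01.
Qed.

Lemma plane_segmentR x y : plane_segment x y y.
Proof.
exists 1; last by rewrite scale1r addrC subrK.
by rewrite /= in_itv /= lexx ler01.
Qed.

Lemma continuous_image_continuum (f : R -> plane) :
  {within `[0, 1], continuous f} -> continuum (f @` `[0, 1]).
Proof.
move=> cf; split; first exact: continuous_compact (@segment_compact _ _ _).
exact: connected_continuous_connected (@segment_connected _ _ _) cf.
Qed.

Lemma continuum_segment x y : continuum (plane_segment x y).
Proof.
apply: continuous_image_continuum; apply: continuous_subspaceT => t.
by apply: cvgD; [exact: cvg_cst | apply: cvgZr_tmp; exact: cvg_id].
Qed.

Lemma plane_segment_ball x y z r :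
  `|x - y| < r -> plane_segment x y z -> `|x - z| < r.
Proof.
move=> xy [t /=]; rewrite in_itv /= => /andP[t0 t1] <-.
rewrite opprD addrA subrr sub0r normrN normrZ ger0_norm // distrC.
by apply: le_lt_trans xy; rewrite ler_piMl.
Qed.

End Continua.

(** * Joining points of a face by continua *)

Section FaceAccess.
Variables (R : realType) (D : set (R * R)) (z0 : R * R).
Hypotheses (clD : closed D) (nDz0 : ~ D z0).

Let F := connected_component (~` D) z0.

Let F_ball w : F w -> exists2 r : R, 0 < r & forall y, `|w - y| < r -> F y.
Proof.
move=> Fw; have nDw : (~` D) w := connected_component_sub Fw.
have /nbhs_ballP[r /= r0 wr] : nbhs w (~` D).
  by apply: open_nbhs_nbhs; split=> //; apply: closed_openC.
exists r => // y wy; rewrite /F (same_connected_component Fw).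
apply: (connected_component_max (B := plane_segment w y)).
- exact: plane_segmentL.
- move=> u us; apply: wr; rewrite -ball_normE /=.
  exact: plane_segment_ball wy us.
- by have [] := continuum_segment w y.
- exact: plane_segmentR.
Qed.

(** The points that can be reached form an open and closed subset of [F], since a segment in a small
    ball can be appended to a continuum. *)
Lemma face_continuum w : F w ->
  exists K, [/\ continuum K, K `<=` F, K z0 & K w].
Proof.
pose Q := [set w | exists K, [/\ continuum K, K `<=` F, K z0 & K w]].
have Fz0 : F z0 by apply: connected_component_refl.
have QF : Q `<=` F by move=> u [K [_ KF _]]; apply: KF.
have grow u v : F u -> (forall y, plane_segment u v y -> F y) -> Q u -> Q v.
  move=> Fu segF [K [cK KF K0 Ku]]; exists (K `|` plane_segment u v); split.
  - apply: continuumU Ku (@plane_segmentL _ u v) cK _.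
    exact: continuum_segment.
  - by move=> y [/KF|/segF].
  - by left.
  - by right; apply: plane_segmentR.
suff FQ : F = Q by move=> Fw; have : Q w by rewrite -FQ.
have op (P : set (R * R)) : P `<=` F ->
    (forall u v, P u -> (forall y, plane_segment u v y -> F y) -> P v) -> open
      P.
  move=> PF Pgrow; rewrite openE => u Pu.
  have [r r0 ur] := F_ball (PF _ Pu).
  apply/nbhs_ballP; exists r => //= v; rewrite -ball_normE /= => uv.
  by apply: Pgrow Pu _ => y us; apply: ur; apply: plane_segment_ball uv us.
apply/esym; apply: (@component_connected _ (~` D) z0).
- exists z0; exists [set z0]; split=> //.
    exact: continuum1.
  by move=> u /= ->.
- exists Q; last by rewrite setIidr.
  by apply: op => // u v Qu segF; apply: (grow u v) => //; apply: QF.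
(* The unreached points form an open set too: a segment from an unreached to a reached point, walked
   backwards, would make its start reachable. *)
- exists (~` (F `\` Q)).
    apply: open_closedC; apply: op; first by move=> u [].
    move=> u v [Fu nQu] segF; split; first exact/segF/plane_segmentR.
    move=> Qv; apply: nQu; apply: (grow v u) => //.
      exact/segF/plane_segmentR.
    move=> y [t /=]; rewrite in_itv /= => /andP[t0 t1] <-; apply: segF.
    exists (1 - t); first by rewrite /= in_itv /= subr_ge0 t1 gerBl.
    by rewrite scalerBl scale1r addrA [u + (v - u)]addrC subrK -scalerN opprB.
  apply/seteqP; split=> u /=.
    by move=> Qu; split; [exact: QF | move=> []].
  by move=> [Fu nFQ]; apply: contrapT => nQu; apply: nFQ.
Qed.

End FaceAccess.

(** * Drawings of K5 and K33 from minors and an apex *)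

Section OuterplanarMinors.
Variables (R : realType) (V : finType) (e : rel V).
Variables (p : V -> R * R) (g : V -> V -> R -> R * R).
Hypotheses (e_sym : symmetric e) (emb : plane_embedding e p g).
Implicit Types (A B : {set V}) (u v w : V) (z : R * R).

Let arc u v : set (R * R) := g u v @` `[0, 1].

Definition vertex_support A : set (R * R) :=
  [set z | (exists2 v, v \in A & z = p v) \/
           exists u v, [/\ u \in A, v \in A, e u v & arc u v z]].

Let arc_ends u v : e u v -> arc u v (p u) /\ arc u v (p v).
Proof.
move=> euv; split.
  exists 0; last exact: (plane_edge_start emb euv).
  by rewrite /= in_itv /= lexx ler01.
exists 1; last exact: (plane_edge_end emb euv).
by rewrite /= in_itv /= lexx ler01.
Qed.

Let arc_cases u v z : e u v -> arc u v z ->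
  [\/ z = p u, z = p v | (g u v @` `]0, 1[) z].
Proof.
move=> euv [t /=]; rewrite in_itv /= => /andP[t0 t1] <-.
have [->|nt0] := eqVneq t 0.
  by constructor 1; apply: (plane_edge_start emb euv).
have [->|nt1] := eqVneq t 1.
  by constructor 2; apply: (plane_edge_end emb euv).
by constructor 3; exists t; rewrite //= in_itv /= !lt_neqAle eq_sym nt0 t0 nt1.
Qed.

Let continuum_arc u v : e u v -> continuum (arc u v).
Proof.
move=> euv; apply: continuous_image_continuum.
exact: (plane_edge_continuous emb euv).
Qed.

Lemma vertex_support_compact A : compact (vertex_support A).
Proof.
pose K (i : V + V * V) : set (R * R) := match i with
  | inl v => if v \in A then [set p v] else set0
  | inr (u, v) => if [&& u \in A, v \in A & e u v] then arc u v else set0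
  end.
rewrite (_ : vertex_support A = [set z | exists i, K i z]).
  apply: finite_union_compact => -[v|[u v]] /=.
    by case: ifP => _; [apply: compact_set1 | apply: compact0].
  case: ifP => [/and3P[_ _ euv]|_]; last exact: compact0.
  by have [] := continuum_arc euv.
apply/seteqP; split=> z /=.
  move=> [[v vA ->]|[u [v [uA vA euv zuv]]]]; first by exists (inl v);
    rewrite /= vA.
  by exists (inr (u, v)); rewrite /= uA vA euv.
move=> [[v|[u v]]] /=; case: ifP => // H zz.
  by left; exists v.
by case/and3P: H => uA vA euv; right; exists u, v.
Qed.

Lemma vertex_support_connected A : conn e A -> connected (vertex_support A).
Proof.
move=> [[r rA] cA].
have Sv v : v \in A -> vertex_support A (p v) by move=> vA; left; exists v.
have Sarc u v : u \in A -> v \in A -> e u v -> arc u v `<=` vertex_support A.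
  by move=> uA vA euv z zuv; right; exists u, v.
have reach v : v \in A -> exists K : set (R * R),
    [/\ connected K, K `<=` vertex_support A, K (p r) & K (p v)].
  move=> vA; have /connectP[q pq ->] := cA _ _ rA vA.
  elim/last_ind: q pq {v vA} => [_|q v IH].
    by exists [set p r]; split=> //; [exact: connected1 | move=> z /= ->;
      apply: Sv].
  rewrite rcons_path last_rcons => /andP[/IH[K [cK KS Kr Kl]] /and3P[lA vA
    elv]].
  have [al av] := arc_ends elv.
  exists (K `|` arc (last r q) v); split.
  - by apply: connectedU => //;
      [exists (p (last r q)) | case: (continuum_arc elv)].
  - by move=> z [/KS|] //; apply: Sarc.
  - by left.
  - by right.
apply: (star_connected (Sv _ rA)) => z [[v vA ->]|[u [v [uA vA euv zuv]]]].
  exact: reach.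
have [K [cK KS Kr Ku]] := reach _ uA.
have [au av] := arc_ends euv.
exists (K `|` arc u v); split.
- by apply: connectedU => //; [exists (p u) | case: (continuum_arc euv)].
- by move=> y [/KS|] //; apply: Sarc.
- by left.
- by right.
Qed.

Lemma vertex_support_disjoint A B : [disjoint A & B]%B ->
  vertex_support A `&` vertex_support B = set0.
Proof.
have arcv u v w : e u v -> arc u v (p w) -> w = u \/ w = v.
  move=> euv /(arc_cases euv)[/(plane_vertex_inj emb)|/(plane_vertex_inj emb)|].
  - by left.
  - by right.
  - by move=> /(plane_edge_vertex emb euv).
have va A' B' w u v : [disjoint A' & B']%B -> w \in A' -> u \in B' -> v \in B'
  ->
    e u v -> arc u v (p w) -> False.
  move=> dAB wA uB vB euv /(arcv _ _ _ euv)[] E; rewrite E in wA.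
    exact: disjoint_mem dAB wA uB.
  exact: disjoint_mem dAB wA vB.
move=> dAB; have dBA : [disjoint B & A]%B by rewrite disjoint_sym.
apply/seteqP; split=> // z [].
move=> [[v vA ->]|[u [v [uA vA euv zuv]]]] [[w wB]|[x [y [xB yB exy zxy]]]].
- move/(plane_vertex_inj emb) => vw; rewrite vw in vA.
  exact: disjoint_mem dAB vA wB.
- exact: (va A B v x y).
- by move=> zw; rewrite zw in zuv; apply: (va B A w u v).
- have [E|E|iuv] := arc_cases euv zuv.
  + by rewrite E in zxy; apply: (va A B u x y).
  + by rewrite E in zxy; apply: (va A B v x y).
  + have [E|E|ixy] := arc_cases exy zxy.
    * by rewrite E in zuv; apply: (va B A x u v).
    * by rewrite E in zuv; apply: (va B A y u v).
    * have nuvxy : ~ (u = x /\ v = y \/ u = y /\ v = x).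
        by move=> [][E _]; rewrite E in uA; apply: (disjoint_mem dAB uA).
      have /seteqP[/(_ z) H _] := plane_edge_disjoint emb euv exy nuvxy.
      exact: H.
Qed.

Lemma vertex_support_setT : vertex_support [set: V]%SET = drawing_support e p g.
Proof.
apply/seteqP; split=> z.
  move=> [[v _ ->]|[u [v [_ _ euv zuv]]]]; first by left; exists v.
  by right; exists u, v.
move=> [[v _ <-]|[u [v [euv zuv]]]]; first by left; exists v.
by right; exists u, v; rewrite !finset.inE.
Qed.

Lemma vertex_support_sub A B :
  A \subset B -> vertex_support A `<=` vertex_support B.
Proof.
move=> /fintype.subsetP sAB z [[v vA ->]|[u [v [uA vA euv zuv]]]].
  by left; exists v => //; apply: sAB.
by right; exists u, v; split=> //; apply: sAB.
Qed.

Variable z0 : R * R.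
Hypothesis nDz0 : ~ drawing_support e p g z0.
Hypothesis bdF : forall v,
  boundary (connected_component (~` drawing_support e p g) z0) (p v).

(** A ball around [p m] misses the drawing [N] of the graph without [m], and it contains a point [w]
    of the face because [p m] is on the boundary. A continuum in the face leads from [z0] to [w],
    and the segment from [w] to [p m] stays in the ball, so it can meet only arcs at [m]. *)
Lemma apex_continuum m : exists S, [/\ continuum S, S z0, S (p m) &
  forall A, m \notin A -> S `&` vertex_support A = set0].
Proof.
have clD : closed (drawing_support e p g).
  rewrite -vertex_support_setT; apply: compact_closed.
    exact: norm_hausdorff.
  exact: vertex_support_compact.
pose N := vertex_support (~: [set m])%SET.
have clN : closed N.
  apply: compact_closed; first exact: norm_hausdorff.
  exact: vertex_support_compact.
have nNm : ~ N (p m).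
  move=> Nm; have d : [disjoint [set m]%SET & (~: [set m])%SET]%B.
    by apply: disjointP2 => x xm; rewrite finset.inE xm.
  have /seteqP[/(_ (p m)) H _] := vertex_support_disjoint d.
  by apply: H; split=> //; left; exists m; rewrite ?finset.set11.
have /nbhs_ballP[r /= r0 mr] : nbhs (p m) (~` N).
  by apply: open_nbhs_nbhs; split=> //; apply: closed_openC.
have [clF _] := bdF m.
have [w [Fw mw]] := clF _ (nbhsx_ballx (p m) r r0).
have [K [cK KF K0 Kw]] := face_continuum clD nDz0 Fw.
exists (K `|` plane_segment (p m) w); split.
- apply: continuumU Kw (@plane_segmentR _ _ _) cK _.
  exact: continuum_segment.
- by left.
- by right; apply: plane_segmentL.
- move=> A mA; apply/seteqP; split=> // z [[Kz|sz] Az].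
    have : (~` drawing_support e p g) z.
      exact: connected_component_sub (KF _ Kz).
    by rewrite -vertex_support_setT; apply; apply: vertex_support_sub Az;
      apply: finset.subsetT.
  apply: (mr z).
    rewrite -ball_normE /=; apply: plane_segment_ball sz.
    by move: mw; rewrite -ball_normE.
  apply: vertex_support_sub Az; apply/fintype.subsetP => x xA.
  by rewrite !finset.inE; apply: contraNneq mA => <-.
Qed.

(** The fifth vertex [ord_max] is the apex [z0]. Two branch sets are joined by the drawing of their
    union, the apex and [A i] by a continuum to the chosen vertex [m i]. *)
Lemma outerplanar_no_K4_minor : no_K4_minor e.
Proof.
move=> A1 A2 A3 A4 c1 c2 c3 c4 d12 d13 d14 d23 d24 d34 a12 a13 a14 a23 a24 a34.
pose A (i : 'I_4) : {set V} := nth finset.set0 [:: A1; A2; A3; A4] i.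
have cA i : conn e (A i) by case: i => [[|[|[|[|//]]]] ?].
have dA i j : i != j -> [disjoint A i & A j]%B.
  case: i j => [[|[|[|[|//]]]] ?] [[|[|[|[|//]]]] ?] //= _;
    by rewrite /A //= disjoint_sym.
have aA i j : i != j -> linked e (A i) (A j).
  case: i j => [[|[|[|[|//]]]] ?] [[|[|[|[|//]]]] ?] //= _;
    by rewrite /A //=; apply: linkedC.
have /choice[m mA] i : exists x, x \in A i by have [] := cA i.
have /choice[Z ZP] i := apex_continuum (m i).
pose S (i j : 'I_5) := match unlift ord_max i, unlift ord_max j with
  | Some i', Some j' => vertex_support (A i' :|: A j')
  | Some i', None | None, Some i' => Z i'
  | None, None => [set z0]
  end.
pose q i := oapp (p \o m) z0 (unlift ord_max i).
have cS i j : continuum (S i j).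
  rewrite /S; case: (unlift ord_max i) (unlift ord_max j) => [i'|] [j'|].
  - split; first exact: vertex_support_compact.
    apply: vertex_support_connected; have [->|nij] := eqVneq i' j'.
      by rewrite finset.setUid.
    by apply: connU => //; apply: aA.
  - by have [] := ZP i'.
  - by have [] := ZP j'.
  - exact: continuum1.
have Sv (i j : 'I_4) : vertex_support (A i :|: A j) (p (m i)).
  by left; exists (m i); rewrite // finset.inE mA.
have nm (i j k : 'I_4) : i != j -> i != k -> m i \notin A j :|: A k.
  move=> ij ik; rewrite finset.inE negb_or; apply/andP; split; apply/negP.
    exact: disjoint_mem (dA _ _ ij) (mA i).
  exact: disjoint_mem (dA _ _ ik) (mA i).
have dUU (i j k l : 'I_4) : i != k -> i != l -> j != k -> j != l ->
    [disjoint A i :|: A j & A k :|: A l]%B.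
  move=> ik il jk jl; apply: disjointP2 => x.
  rewrite !finset.inE => /orP[]xi /orP[]xj.
  - exact: disjoint_mem (dA _ _ ik) xi xj.
  - exact: disjoint_mem (dA _ _ il) xi xj.
  - exact: disjoint_mem (dA _ _ jk) xi xj.
  - exact: disjoint_mem (dA _ _ jl) xi xj.
apply: (@K5_nonplanar R q S).
- by move=> i j; have [] := cS i j.
- by move=> i j; have [] := cS i j.
- move=> i j; rewrite /S /q.
  case: (unlift ord_max i) (unlift ord_max j) => [i'|] [j'|] //=.
    by have [] := ZP i'.
  by have [] := ZP j'.
- move=> i j; rewrite /S /q.
  case: (unlift ord_max i) (unlift ord_max j) => [i'|] [j'|] //=.
  + by rewrite finset.setUC.
  + by have [] := ZP i'.
  + by have [] := ZP j'.
- move=> i j k l; rewrite /S /= !inE.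
  case: (unliftP ord_max i) => [i'|] ->; case: (unliftP ord_max j) => [j'|] ->;
  case: (unliftP ord_max k) => [k'|] ->; case: (unliftP ord_max l) => [l'|] ->;
  rewrite ?eqxx ?orbT ?andbF //= !(inj_eq lift_inj) ?negb_or //.
  + by case/and4P=> /and3P[_ ? ?] /andP[? ?] _ _;
      apply/vertex_support_disjoint/dUU.
  + case/and4P=> /and3P[_ ik _] /andP[jk _] _ _; rewrite setIC.
    by have [_ _ _] := ZP k'; apply; apply: nm; rewrite eq_sym.
  + case/and4P=> /and3P[_ _ il] /andP[_ jl] _ _; rewrite setIC.
    by have [_ _ _] := ZP l'; apply; apply: nm; rewrite eq_sym.
  + case/and4P=> /and3P[_ ik il] _ _ _.
    by have [_ _ _] := ZP i'; apply; apply: nm.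
  + case/and4P=> _ /andP[jk jl] _ _.
    by have [_ _ _] := ZP j'; apply; apply: nm.
Qed.

(** The apex joins [A] and [B] as the third vertex on their side of a K33. *)
Lemma outerplanar_no_K23_minor : no_K23_minor e.
Proof.
move=> A B M1 M2 M3 cA cB c1 c2 c3 dAB dA1 dA2 dA3 dB1 dB2 dB3 d12 d13 d23.
move=> aA1 aA2 aA3 aB1 aB2 aB3.
pose M (j : 'I_3) : {set V} := nth finset.set0 [:: M1; M2; M3] j.
have cM j : conn e (M j) by case: j => [[|[|[|//]]] ?].
have dA j : [disjoint A & M j]%B by case: j => [[|[|[|//]]] ?].
have dB j : [disjoint B & M j]%B by case: j => [[|[|[|//]]] ?].
have aA j : linked e A (M j) by case: j => [[|[|[|//]]] ?].
have aB j : linked e B (M j) by case: j => [[|[|[|//]]] ?].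
have dM i j : i != j -> [disjoint M i & M j]%B.
  case: i j => [[|[|[|//]]] ?] [[|[|[|//]]] ?] //= _;
    by rewrite /M //= disjoint_sym.
have [[x xA] _] := cA; have [[y yB] _] := cB.
have /choice[m mM] j : exists v, v \in M j by have [] := cM j.
have /choice[Z ZP] j := apex_continuum (m j).
(* At the third index [nth] returns its default, which is the apex. *)
pose a (i : 'I_3) := nth z0 [:: p x; p y] i.
pose S (i j : 'I_3) := match val i with
  | 0 => vertex_support (A :|: M j)
  | 1 => vertex_support (B :|: M j)
  | _ => Z j
  end%N.
have cS i j : continuum (S i j).
  case: i => [[|[|[|//]]] ?]; rewrite /S /=.
  - split; first exact: vertex_support_compact.
    by apply: vertex_support_connected; apply: connU.
  - split; first exact: vertex_support_compact.
    by apply: vertex_support_connected; apply: connU.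
  - by have [] := ZP j.
have dAMBM j j' : j != j' -> [disjoint A :|: M j & B :|: M j']%B.
  move=> jj'; apply: disjointP2 => v; rewrite !finset.inE => /orP[]vi /orP[]vj.
  - exact: disjoint_mem dAB vi vj.
  - exact: disjoint_mem (dA j') vi vj.
  - exact: disjoint_mem (dB j) vj vi.
  - exact: disjoint_mem (dM _ _ jj') vi vj.
have nm (C : {set V}) j j' : [disjoint C & M j]%B -> j != j' ->
    m j \notin C :|: M j'.
  move=> dC jj'; rewrite finset.inE negb_or; apply/andP; split; apply/negP.
    by move=> mC; apply: disjoint_mem dC mC (mM j).
  exact: disjoint_mem (dM _ _ jj') (mM j).
apply: (@K33_nonplanar R a (p \o m) S).
- by move=> i j; have [] := cS i j.
- by move=> i j; have [] := cS i j.
- move=> [[|[|[|//]]] ?] j; rewrite /S /a /=.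
  + by left; exists x; rewrite // finset.inE xA.
  + by left; exists y; rewrite // finset.inE yB.
  + by have [] := ZP j.
- move=> [[|[|[|//]]] ?] j; rewrite /S /=.
  + by left; exists (m j); rewrite // finset.inE mM orbT.
  + by left; exists (m j); rewrite // finset.inE mM orbT.
  + by have [] := ZP j.
- move=> i j i' j' ii' jj'; have j'j : j' != j by rewrite eq_sym.
  move: i i' ii' => [[|[|[|//]]] ?] [[|[|[|//]]] ?] //= _; rewrite /S /=.
  + exact/vertex_support_disjoint/dAMBM.
  + by rewrite setIC; have [_ _ _] := ZP j'; apply; apply: nm.
  + by rewrite setIC; apply/vertex_support_disjoint/dAMBM.
  + by rewrite setIC; have [_ _ _] := ZP j'; apply; apply: nm.
  + by have [_ _ _] := ZP j; apply; apply: nm.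
  + by have [_ _ _] := ZP j; apply; apply: nm.
Qed.

End OuterplanarMinors.

(** * Drawing the Farey graph *)

From mathcomp Require Import zify ring.

Section FareyDrawing.

Let A := {poly {poly int}}.

(** [true] is the outer variable, later evaluated at [x], and [false] the variable of the
    coefficients, evaluated at [y]. Taking the coefficient of index 0 thus means setting [x] to
    0. *)
Definition rhombus_var (t : bool) : A := if t then 'X else ('X)%:P.

Local Notation X := rhombus_var.

(* [strip_pos t j a] is the position of the vertex with address [a] below the
   [j]-th rung [X t *+ j, 1 + X t *+ j] of a strip of rhombi with rungs of
   direction [1] and rails of direction [X t]; [rhombus_pos] does the same below
   the diagonal [X t *+ j.+1, 1 + X t *+ j] of the [j]-th rhombus of the strip.
   The parity of [j] selects the variable used by the strips that leave the
   [j]-th rhombus through its two rails. *)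
Fixpoint strip_pos (t : bool) (j : nat) (a : seq bool) {struct a} : A :=
  match a with
  | [::] => X t *+ j.+1
  | false :: a' => X t *+ j + X t * strip_pos (odd j) 0 a'
  | true :: a' => rhombus_pos t j a'
  end
with rhombus_pos (t : bool) (j : nat) (a : seq bool) {struct a} : A :=
  match a with
  | [::] => 1 + X t *+ j.+1
  | false :: a' => strip_pos t j.+1 a'
  | true :: a' => 1 + X t *+ j.+1 - X t * strip_pos (odd j) 0 a'
  end.

Section Lengths.
(** [ok p] stands for: the value of [p] has one of the three lengths. Multiplication by a variable
    preserves it because [x] and [y] have modulus 1. *)
Variables (ok : A -> Prop).
Hypotheses (ok1 : ok 1) (okB : forall t, ok (1 - X t)).
Hypotheses (okN : forall p, ok p -> ok (- p)).
Hypotheses (okM : forall t p, ok p -> ok (X t * p)).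

Let okX t : ok (X t).
Proof. by rewrite -[X t]mulr1; apply: okM. Qed.

(** Addresses made of [false] are the neighbours of the left end, which is [X t *+ j] for a rung and
    [X t *+ j.+1] for a diagonal. In [ok_right] the right end is [1 + X t *+ j] for both. *)
Let ok_left n t j : ok (strip_pos t j (nseq n false) - X t *+ j) /\
  ok (rhombus_pos t j (nseq n false) - X t *+ j.+1).
Proof.
elim: n t j => [|n IH] t j /=; first by rewrite mulrSr addrAC subrr add0r addrK.
rewrite addrAC subrr add0r; split; last by have [] := IH t j.+1.
by apply: okM; have [] := IH (odd j) 0; rewrite mulr0n subr0.
Qed.

Let ok_right n t j : ok (strip_pos t j (nseq n true) - (1 + X t *+ j)) /\
  ok (rhombus_pos t j (nseq n true) - (1 + X t *+ j)).
Proof.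
elim: n t j => [|n IH] t j /=.
  split; last by rewrite mulrSr addrA [_ + X t]addrC addrK.
  have -> : X t *+ j.+1 - (1 + X t *+ j) = - (1 - X t) by rewrite mulrSr; ring.
  exact: okN.
split; first by have [] := IH t j.
have [+ _] := IH (odd j) 0; rewrite mulr0n addr0 => okw.
set w := strip_pos _ _ _ in okw *.
have -> : 1 + X t *+ j.+1 - X t * w - (1 + X t *+ j) = - (X t * (w - 1)).
  by rewrite mulrSr; ring.
by apply: okN; apply: okM.
Qed.

Let ok_adj_right b n t j :
  ok (strip_pos t j (b ++ true :: nseq n false) - strip_pos t j b) /\
  ok (rhombus_pos t j (b ++ true :: nseq n false) - rhombus_pos t j b).
Proof.
elim: b t j => [| [] b IH] t j /=.
- split; first by have [] := ok_left n t j.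
  rewrite addrAC subrr add0r; apply: okN; apply: okM.
  by have [] := ok_left n (odd j) 0; rewrite mulr0n subr0.
- split; first by have [] := IH t j.
  have [H _] := IH (odd j) 0.
  rewrite opprD addrACA subrr add0r -opprD -mulrBr.
  by apply: okN; apply: okM.
- split; last by have [] := IH t j.+1.
  rewrite opprD addrACA subrr add0r -mulrBr; apply: okM.
  by have [] := IH (odd j) 0.
Qed.

Let ok_adj_left b n t j :
  ok (strip_pos t j (b ++ false :: nseq n true) - strip_pos t j b) /\
  ok (rhombus_pos t j (b ++ false :: nseq n true) - rhombus_pos t j b).
Proof.
elim: b t j => [| [] b IH] t j /=.
- split; last by have [] := ok_right n t j.+1.
  have [+ _] := ok_right n (odd j) 0; rewrite mulr0n addr0 => okw.
  rewrite mulrSr opprD addrACA subrr add0r -[Y in _ - Y]mulr1 -mulrBr.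
  exact: okM.
- split; first by have [] := IH t j.
  have [H _] := IH (odd j) 0.
  rewrite opprD addrACA subrr add0r -opprD -mulrBr.
  by apply: okN; apply: okM.
- split; last by have [] := IH t j.+1.
  rewrite opprD addrACA subrr add0r -mulrBr; apply: okM.
  by have [] := IH (odd j) 0.
Qed.

Lemma strip_pos_adj t j b a :
  farey_adj b a -> ok (strip_pos t j a - strip_pos t j b).
Proof.
move=> [n [->|->]]; first by have [] := ok_adj_right b n t j.
by have [] := ok_adj_left b n t j.
Qed.

End Lengths.

(* [strip_code k c tl] goes [k] rhombi up the strip and then stops ([tl = None])
   at the new vertex of the rhombus on the rail [c], or leaves through the rail
   [c] along [tl]. *)
Fixpoint strip_code (k : nat) (c : bool) (tl : option (seq bool)) : seq bool :=
  match k with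
  | 0 => match c, tl with
         | false, None => [::]
         | false, Some s => false :: s
         | true, None => [:: true]
         | true, Some s => true :: true :: s
         end
  | k'.+1 => true :: false :: strip_code k' c tl
  end.

(** What is left of a position after subtracting [c] and dividing by [X t], as in
    [strip_pos_code]. *)
Definition rail_pos (j : nat) (c : bool) (tl : option (seq bool)) : A :=
  match c, tl with
  | _, None => j.+1%:R
  | false, Some s => j%:R + strip_pos (odd j) 0 s
  | true, Some s => j.+1%:R - strip_pos (odd j) 0 s
  end.

Lemma strip_pos_code t j k c tl :
  strip_pos t j (strip_code k c tl) = c%:R + X t * rail_pos (j + k) c tl.
Proof.
elim: k j => [|k IH] j /=; last by rewrite IH addSnnS.
rewrite addn0; case: c; case: tl => [s|] //=;
  rewrite ?add0r ?mulrDr ?mulrN ?mulr_natr //.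
by rewrite addrA.
Qed.

Lemma strip_codeP a : exists k c tl,
  a = strip_code k c tl /\ (if tl is Some s then size s < size a else true)%N.
Proof.
have [n] := ubnP (size a); elim: n a => // n IH [_| [] a].
- by exists 0%N, false, None.
- case: a => [| [] a] /= ltan.
  + by exists 0%N, true, None.
  + by exists 0%N, true, (Some a); split=> //=; lia.
  + have [|k [c [tl [-> ltl]]]] := IH a; first by lia.
    exists k.+1, c, tl; split=> //=.
    by case: tl ltl => //= s; lia.
- by move=> _; exists 0%N, false, (Some a).
Qed.

Lemma coef00_rhombus_var t (p : A) : (X t * p)`_0`_0 = 0.
Proof.
by case: t; rewrite /rhombus_var ?coefXM ?coefCM ?coefXM //= coef0.
Qed.

Lemma coef0_natr n : ((n%:R : A)`_0 = n%:R) * ((n%:R : A)`_0`_0 = n%:R).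
Proof. by rewrite -!polyC_natr !coefC. Qed.

Lemma polyXD_natr_neq0 n (r : {poly int}) : r != 0 -> 'X * r + n%:R != 0.
Proof.
move=> r0; apply/eqP => /(congr1 (fun p : {poly int} => size (p - n%:R))).
rewrite addrK sub0r size_polyN mulrC size_mulX // => sz.
have := size_polyC_leq1 (n%:R : int); rewrite polyC_natr -sz ltnS leqn0.
by rewrite size_poly_eq0 (negPf r0).
Qed.

Lemma natr_polyint_eq0 n : ((n%:R : {poly int}) == 0) = (n == 0)%N.
Proof. by rewrite -polyC_natr polyC_eq0 pnatr_eq0. Qed.

(** Set [x] to 0. For odd [j] the side strip has variable [x], and a natural number remains that is
    positive because [j] is. For even [j] the variable is [y], whose cofactor is nonzero by
    induction. Thus the rhombus 0, where the number may vanish, has to be given [y]. *)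
Lemma coef0_rail_pos j c tl : (rail_pos j c tl)`_0 != 0.
Proof.
have [n] := ubnP (if tl is Some s then (size s).+1 else 0%N).
elim: n j c tl => // n IH j c [s|] ltn; last first.
  by case: c; rewrite /= coef0_natr natr_polyint_eq0.
have [k [c' [tl' [def_s ltl']]]] := strip_codeP s.
have r0 : (rail_pos k c' tl')`_0 != 0.
  by apply: IH; case: tl' ltl' {def_s} => [s'|] /=; lia.
set r := rail_pos k c' tl' in r0.
have -> : rail_pos j c (Some s) =
    (if c then j.+1 - c' else j + c')%N%:R + (-1) ^+ c * (X (odd j) * r).
  case: c {ltn}; rewrite /= def_s strip_pos_code add0n -/r.
    by rewrite expr1 mulN1r natrB ?(leq_trans (leq_b1 _)) // opprD addrA.
  by rewrite expr0 mul1r natrD addrA.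
rewrite coefD coef0_natr.
have -> : ((-1) ^+ c * (X (odd j) * r))`_0 = (-1) ^+ c * (X (odd j) * r)`_0.
  by case: (c); rewrite ?expr1 ?expr0 ?mul1r // !mulN1r coefN.
case: (boolP (odd j)) => oj; rewrite /rhombus_var.
  rewrite coefXM /= mulr0 addr0 natr_polyint_eq0.
  by case: j oj => // j _; case: c {ltn}; case: c' {def_s r0 r}; lia.
rewrite coefCM mulrCA addrC; apply: polyXD_natr_neq0.
by rewrite mulf_neq0 // signr_eq0.
Qed.

Lemma rhombus_var_neq0 t : X t != 0.
Proof.
by case: t; rewrite /rhombus_var ?polyC_eq0 polyX_eq0.
Qed.

Lemma rhombus_var_mul_inj t t' (r r' : A) : r`_0 != 0 -> r'`_0 != 0 ->
  X t * r = X t' * r' -> t = t'.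
Proof.
(* Setting [x] to 0 kills the left side but not the right one. *)
have neq (p p' : A) : p'`_0 != 0 -> 'X * p = ('X)%:P * p' -> False.
  move=> p0 /(congr1 (fun q : A => q`_0)); rewrite coefXM coefCM /=.
  by move/esym/eqP; rewrite mulf_eq0 polyX_eq0 (negPf p0).
case: t; case: t' => // r0 r0' eqX; first by case: (neq r r').
by case: (neq r' r).
Qed.

Lemma natr_poly_inj : injective (fun n : nat => n%:R : A).
Proof.
move=> m n /(congr1 (fun p : A => p`_0`_0)); rewrite !coef0_natr.
by move/eqP; rewrite eqr_nat => /eqP.
Qed.

(** The constant term gives the rail [c]. After division by [X t], the next constant term gives [k]
    up to one, because the rail taken next contributes 0 or 1. The variable dividing the rest gives
    the parity of [k], hence [k]; the tail follows by induction. *)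
Lemma strip_pos_inj t : injective (strip_pos t 0).
Proof.
move=> a; have [n] := ubnP (size a); elim: n t a => // n IH t a ltan a'.
have [k [c [tl [def_a ltl]]]] := strip_codeP a.
have [k' [c' [tl' [def_a' ltl']]]] := strip_codeP a'.
rewrite def_a def_a' !strip_pos_code !add0n => eq_pos.
have eqc : c = c'.
  have := congr1 (fun p : A => p`_0`_0) eq_pos.
  rewrite !coefD !coef00_rhombus_var !coef0_natr !addr0.
  by case: (c); case: (c') => // /eqP; rewrite eqr_nat.
move: eq_pos; rewrite -eqc => /addrI /(mulfI (rhombus_var_neq0 t)).
(* A vertex inside a side strip is never on the rail: otherwise [X (odd j) * r] would be an integer
   with zero constant term, hence 0. *)
have noint m j d s : m%:R = rail_pos j d (Some s) -> False.
  have [l [d' [u [-> _]]]] := strip_codeP s.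
  have /eqP r0 := coef0_rail_pos l d' u; set r := rail_pos l d' u in r0.
  rewrite /rail_pos => eqm.
  have [i Xr] : exists i : int, X (odd j) * r = i%:~R.
    case: d eqm; rewrite strip_pos_code add0n -/r => eqm.
      exists (j.+1%:Z - m%:Z - d'%:Z); rewrite !rmorphB /=.
      by rewrite -!pmulrn eqm; ring.
    exists (m%:Z - j%:Z - d'%:Z); rewrite !rmorphB /=.
    by rewrite -!pmulrn eqm; ring.
  have i0 : i = 0.
    have := coef00_rhombus_var (odd j) r; rewrite Xr.
    have -> : i%:~R = ((i%:~R)%:P)%:P :> A by rewrite !rmorph_int.
    by rewrite !coefC /= intz.
  move: Xr; rewrite i0 mulr0z => /eqP.
  by rewrite mulf_eq0 (negPf (rhombus_var_neq0 _)) => /eqP r00; apply: r0;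
    rewrite r00 coef0.
rewrite -eqc in def_a' *;
  case: tl tl' ltl ltl' {def_a def_a'} => [s|] [s'|] lts lts' eq_rail.
- have [l [d [u [def_s _]]]] := strip_codeP s.
  have [l' [d' [u' [def_s' _]]]] := strip_codeP s'.
  have r0 := coef0_rail_pos l d u; have r0' := coef0_rail_pos l' d' u'.
  set r := rail_pos l d u in r0; set r' := rail_pos l' d' u' in r0'.
  have eq_s : strip_pos (odd k) 0 s = d%:R + X (odd k) * r.
    by rewrite def_s strip_pos_code.
  have eq_s' : strip_pos (odd k') 0 s' = d'%:R + X (odd k') * r'.
    by rewrite def_s' strip_pos_code.
  have [eqk eqX] : (if c then k + d' = k' + d else k + d = k' + d')%N /\
      X (odd k) * r = X (odd k') * r'.
    have H : (if c then k + d' else k + d)%N%:R + (-1) ^+ c * (X (odd k) * r) =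
             (if c then k' + d else k' + d')%N%:R + (-1) ^+ c * (X (odd k') *
               r').
      move: eq_rail; rewrite /rail_pos; case: (c); rewrite eq_s eq_s'.
        rewrite expr1 !mulN1r !natrD -!natr1 => eq_rail.
        apply: (addrI (1 - d%:R - d'%:R)).
        transitivity (k%:R + 1 - (d%:R + X (odd k) * r)); first by ring.
        by rewrite eq_rail; ring.
      by rewrite expr0 !mul1r !natrD -!addrA.
    have H0 := congr1 (fun p : A => p`_0`_0) H.
    have sgn (p : A) : ((-1) ^+ c * p)`_0`_0 = (-1) ^+ c * p`_0`_0.
      by case: (c); rewrite ?expr1 ?expr0 ?mul1r // !mulN1r !coefN.
    move: H0; rewrite !coefD !sgn !coef00_rhombus_var !mulr0 !addr0 !coef0_natr.
    move/eqP; rewrite eqr_nat => /eqP eqn; split.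
      by case: (c) eqn.
    by move: H; rewrite eqn => /addrI /(mulfI _); apply; rewrite signr_eq0.
  have oddk := rhombus_var_mul_inj r0 r0' eqX.
  have eqkk : k = k' by case: c d d' eqk {eq_rail eq_s eq_s' def_s def_s' r r0
    eqX r' r0' eqc IH} => [] [] []; lia.
  rewrite eqkk; congr (strip_code _ _ (Some _)).
  apply: (IH (odd k')); first by lia.
  move: eq_rail; rewrite eqkk /rail_pos; case: (c) => /addrI //.
  exact: oppr_inj.
- by case: (noint k'.+1 k c s); rewrite eq_rail; case: (c).
- by case: (noint k.+1 k' c s'); rewrite -eq_rail; case: (c).
- by move: eq_rail; rewrite /rail_pos; case: (c) => /natr_poly_inj [->].
Qed.

End FareyDrawing.

(** * Evaluation of the positions at complex numbers *)

Section Evaluation.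
Variables (K : numFieldType) (x y : K).

Definition eval_y (p : {poly int}) : K := (map_poly intr p).[y].
Definition eval_xy (p : {poly {poly int}}) : K := (map_poly eval_y p).[x].

Fact eval_y_is_zmod_morphism : zmod_morphism eval_y.
Proof. by move=> p q; rewrite /eval_y rmorphB hornerD hornerN. Qed.

Fact eval_y_is_monoid_morphism : monoid_morphism eval_y.
Proof.
by split=> [|p q]; rewrite /eval_y ?rmorph1 ?hornerC // rmorphM hornerM.
Qed.

HB.instance Definition _ :=
  GRing.isZmodMorphism.Build _ _ eval_y eval_y_is_zmod_morphism.
HB.instance Definition _ :=
  GRing.isMonoidMorphism.Build _ _ eval_y eval_y_is_monoid_morphism.

Fact eval_xy_is_zmod_morphism : zmod_morphism eval_xy.
Proof. by move=> p q; rewrite /eval_xy rmorphB hornerD hornerN. Qed.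

Fact eval_xy_is_monoid_morphism : monoid_morphism eval_xy.
Proof.
by split=> [|p q]; rewrite /eval_xy ?rmorph1 ?hornerC // rmorphM hornerM.
Qed.

HB.instance Definition _ :=
  GRing.isZmodMorphism.Build _ _ eval_xy eval_xy_is_zmod_morphism.
HB.instance Definition _ :=
  GRing.isMonoidMorphism.Build _ _ eval_xy eval_xy_is_monoid_morphism.

Lemma eval_rhombus_var t : eval_xy (rhombus_var t) = if t then x else y.
Proof.
rewrite /eval_xy; case: t; first by rewrite map_polyX hornerX.
by rewrite map_polyC hornerC /= /eval_y map_polyX hornerX.
Qed.

Lemma farey_drawing : `|x| = 1 -> `|y| = 1 ->
  (forall p, p != 0 -> eval_xy p != 0) ->
  exists2 pos : seq bool -> K, injective pos &
    forall b a, farey_adj b a ->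
      `|pos a - pos b| \in [:: 1; `|1 - x|; `|1 - y|].
Proof.
move=> nx ny indep; exists (fun a => eval_xy (strip_pos false 0 a)).
  move=> a b eq_ab; apply: (@strip_pos_inj false); apply/eqP; rewrite -subr_eq0.
  by apply/negPn/negP => /indep; rewrite rmorphB /= eq_ab subrr eqxx.
move=> b a ba; rewrite -rmorphB.
have := @strip_pos_adj (fun p => `|eval_xy p| \in [:: 1; `|1 - x|; `|1 - y|]).
apply=> // [|t|p|t p].
- by rewrite rmorph1 normr1 mem_head.
- by rewrite rmorphB rmorph1 /= eval_rhombus_var; case: t;
    rewrite !inE eqxx ?orbT.
- by rewrite rmorphN normrN.
- by rewrite rmorphM /= normrM eval_rhombus_var; case: t; rewrite ?nx ?ny mul1r.
Qed.

End Evaluation.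

(** * Generic triples of lengths *)

Section UnitCircle.
Variable R : realType.
Implicit Types (r s : R).

(* The unit complex number at distance [r] from [1], for [0 <= r <= 2]. *)
Definition chord_point r : R[i] :=
  Complex (1 - r ^+ 2 / 2) (Num.sqrt (1 - (1 - r ^+ 2 / 2) ^+ 2)).

Lemma chord_point_norms r : 0 <= r <= 2 ->
  `|chord_point r| = 1 /\ `|1 - chord_point r| = r%:C%C.
Proof.
move=> /andP[r0 r2].
have h : 0 <= 1 - (1 - r ^+ 2 / 2) ^+ 2.
  have -> : 1 - (1 - r ^+ 2 / 2) ^+ 2 = r ^+ 2 * (2 - r) * (2 + r) / 4 by field.
  apply: divr_ge0 => //; apply: mulr_ge0; last by lra.
  by apply: mulr_ge0; [exact: sqr_ge0 | lra].
split; rewrite normc_def /= ?sub0r ?sqrrN sqr_sqrtr //.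
  by rewrite addrC subrK sqrtr1.
have -> : (1 - (1 - r ^+ 2 / 2)) ^+ 2 + (1 - (1 - r ^+ 2 / 2) ^+ 2) = r ^+ 2.
  by field.
by rewrite sqrtr_sqr ger0_norm.
Qed.

(** A positive [r] is recovered from [z = chord_point r] as the square root of [2 - 2 * Re z], so
    there are at most as many [r] as roots. *)
Lemma finite_chord_roots (q : {poly R[i]}) : q != 0 ->
  finite_set [set r | 0 < r /\ q.[chord_point r] = 0].
Proof.
move=> q0; have [rs def_q] := closed_field_poly_normal q.
apply: (@sub_finite_set _ _
  ((fun z : R[i] => Num.sqrt (2 - 2 * complex.Re z)) @` [set` rs])).
  move=> r /= [r0 /eqP]; rewrite {1}def_q hornerZ mulf_eq0 lead_coef_eq0.
  rewrite (negPf q0) -/(root _ _) root_prod_XsubC => rrs.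
  exists (chord_point r) => //=.
  have -> : 2 - 2 * (1 - r ^+ 2 / 2) = r ^+ 2 by field.
  by rewrite sqrtr_sqr gtr0_norm.
exact/finite_image/finite_seq.
Qed.

Definition chord_zeros (p : {poly {poly int}}) : set (R * R) :=
  [set rs | [/\ 0 < rs.1, 0 < rs.2 &
    eval_xy (chord_point rs.1) (chord_point rs.2) p = 0]].

(** [Q] is where the leading coefficient of [p], a polynomial in [y], vanishes. Elsewhere a nonzero
    polynomial in [x] remains. *)
Lemma finite_chord_zeros p : p != 0 -> exists2 Q : set R, finite_set Q &
  forall s, 0 < s -> ~ Q s -> finite_set [set r | chord_zeros p (r, s)].
Proof.
move=> p0; pose q := map_poly (intr : int -> R[i]) (lead_coef p).
have q0 : q != 0.
  rewrite map_poly_eq0_id0 ?lead_coef_eq0 // intr_eq0 lead_coef_eq0.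
  by rewrite lead_coef_eq0.
exists [set s | 0 < s /\ q.[chord_point s] = 0];
  first exact: finite_chord_roots.
move=> s s0 nQ.
pose ps := map_poly (eval_y (chord_point s)) p.
apply: (@sub_finite_set _ _ [set r | 0 < r /\ ps.[chord_point r] = 0]).
  by move=> r [].
apply: finite_chord_roots; rewrite map_poly_eq0_id0 //.
by apply/eqP => H; apply: nQ.
Qed.

End UnitCircle.

(** * Measurability of complex polynomial expressions *)

Section ComplexMeasurable.
Context (d : measure_display) (T : measurableType d) (R : realType).
Implicit Types (f g : T -> R[i]).

Definition cmeasurable f : Prop :=
  measurable_fun setT (fun t => complex.Re (f t)) /\
  measurable_fun setT (fun t => complex.Im (f t)).

Lemma cmeasurable_cst z : cmeasurable (fun=> z).
Proof. by split; apply: measurable_cst. Qed.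

Lemma cmeasurableD f g :
  cmeasurable f -> cmeasurable g -> cmeasurable (fun t => f t + g t).
Proof.
move=> [rf jf] [rg jg]; split.
  rewrite (_ : (fun t => _) = (fun t => complex.Re (f t) + complex.Re (g t))).
    exact: measurable_funD.
  by apply/funext => t; rewrite raddfD.
rewrite (_ : (fun t => _) = (fun t => complex.Im (f t) + complex.Im (g t))).
  exact: measurable_funD.
by apply/funext => t; rewrite raddfD.
Qed.

Lemma cmeasurableM f g :
  cmeasurable f -> cmeasurable g -> cmeasurable (fun t => f t * g t).
Proof.
move=> [rf jf] [rg jg]; split.
  rewrite (_ : (fun t => _) =
      (fun t => complex.Re (f t) * complex.Re (g t) - complex.Im (f t) *
        complex.Im (g t))).
    by apply: measurable_funB; apply: measurable_funM.
  by apply/funext => t; case: (f t) => a b; case: (g t).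
rewrite (_ : (fun t => _) =
    (fun t => complex.Re (f t) * complex.Im (g t) + complex.Im (f t) *
      complex.Re (g t))).
  by apply: measurable_funD; apply: measurable_funM.
by apply/funext => t; case: (f t) => a b; case: (g t).
Qed.

Lemma cmeasurable_eval f g p : cmeasurable f -> cmeasurable g ->
  cmeasurable (fun t => eval_xy (f t) (g t) p).
Proof.
move=> mf mg; have my q : cmeasurable (fun t => eval_y (g t) q).
  elim/poly_ind: q => [|q c IH].
    rewrite (_ : (fun t => _) = (fun=> 0)); first exact: cmeasurable_cst.
    by apply/funext => t; rewrite rmorph0.
  rewrite (_ : (fun t => _) = (fun t => eval_y (g t) q * g t + c%:~R)).
    exact: cmeasurableD (cmeasurableM IH mg) (cmeasurable_cst _).
  apply/funext => t; rewrite rmorphD rmorphM /=; congr (_ * _ + _).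
    by rewrite /eval_y map_polyX hornerX.
  by rewrite /eval_y map_polyC hornerC.
elim/poly_ind: p => [|p q IH].
  rewrite (_ : (fun t => _) = (fun=> 0)); first exact: cmeasurable_cst.
  by apply/funext => t; rewrite rmorph0.
rewrite (_ : (fun t => _) =
    (fun t => eval_xy (f t) (g t) p * f t + eval_y (g t) q)).
  exact: cmeasurableD (cmeasurableM IH mf) (my q).
apply/funext => t; rewrite rmorphD rmorphM /=; congr (_ * _ + _).
  by rewrite /eval_xy map_polyX hornerX.
by rewrite /eval_xy map_polyC hornerC.
Qed.

Lemma cmeasurable_zeros f : cmeasurable f -> measurable [set t | f t = 0].
Proof.
move=> [rf jf].
rewrite (_ : [set t | _] = (fun t => complex.Re (f t)) @^-1` [set 0] `&`
    (fun t => complex.Im (f t)) @^-1` [set 0]).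
  by apply: measurableI; rewrite -[X in measurable X]setTI;
    [apply: rf | apply: jf].
apply/seteqP; split=> t /=; first by move=> ->.
by case: (f t) => a b /= [-> ->].
Qed.

Lemma cmeasurable_chord_point (h : T -> R) :
  measurable_fun setT h -> cmeasurable (fun t => chord_point (h t)).
Proof.
move=> mh; have mre : measurable_fun setT (fun t => 1 - h t ^+ 2 / 2).
  apply: measurable_funB; first exact: measurable_cst.
  apply: measurable_funM; last exact: measurable_cst.
  exact: measurable_funX.
split=> //=; apply: (measurableT_comp (f := @Num.sqrt R)).
  exact: continuous_measurable_fun (@sqrt_continuous R).
apply: measurable_funB; first exact: measurable_cst.
exact: measurable_funX.
Qed.

Lemma measurable_chord_zeros p (h k : T -> R) :
  measurable_fun setT h -> measurable_fun setT k ->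
  measurable [set t | chord_zeros p (h t, k t)].
Proof.
move=> mh mk.
rewrite (_ : [set t | _] = h @^-1` `]0, +oo[ `&` (k @^-1` `]0, +oo[ `&`
    [set t | eval_xy (chord_point (h t)) (chord_point (k t)) p = 0])).
  apply: measurableI; first by rewrite -[X in measurable X]setTI; apply: mh.
  apply: measurableI; first by rewrite -[X in measurable X]setTI; apply: mk.
  by apply: cmeasurable_zeros; apply: cmeasurable_eval;
    apply: cmeasurable_chord_point.
apply/seteqP; split=> t /=.
  by move=> [h0 k0 ev0]; rewrite !in_itv /= !andbT.
by rewrite !in_itv /= !andbT => -[h0 [k0 ev0]]; split.
Qed.

End ComplexMeasurable.

(** * Null sets by slicing *)

Section NullSets.
Context (R : realType).
Local Notation mu := (@lebesgue_measure R).

Local Notation RT := (measurableTypeR R).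

Lemma measurable_idTR : measurable_fun setT (idfun : RT -> R).
Proof. by move=> _ A mA; rewrite setTI. Qed.

Lemma finite_lebesgue_measure0 (A : set R) : finite_set A -> mu A = 0%E.
Proof. by move=> /finite_set_countable /countable_lebesgue_measure0. Qed.

Lemma finite_measurable (A : set R) : finite_set A -> measurable A.
Proof.
by move=> /finite_set_countable; apply: countable_measurable;
  apply: measurable_set1.
Qed.

Section Product.
Context (d1 d2 : measure_display).
Context (T1 : measurableType d1) (T2 : measurableType d2).

Lemma product_measure_xsection0 (m1 : {measure set T1 -> \bar R})
    (m2 : {measure set T2 -> \bar R}) (A : set (T1 * T2)) :
  (forall x, m2 (xsection A x) = 0%E) -> (m1 \x m2)%E A = 0%E.
Proof.
move=> A0; rewrite /product_measure1.
by under eq_integral => x _ do rewrite /= A0; rewrite integral0.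
Qed.

Lemma product_measure_ysection0
    (m1 : {sigma_finite_measure set T1 -> \bar R})
    (m2 : {sigma_finite_measure set T2 -> \bar R}) (A : set (T1 * T2)) :
  measurable A ->
  (forall y, m1 (ysection A y) = 0%E) -> (m1 \x m2)%E A = 0%E.
Proof.
move=> mA A0.
rewrite (product_measure_unique (m' := (m1 \x^ m2)%E)) //; last first.
  by move=> B C mB mC; exact: product_measure2E.
transitivity (\int[m2]_y (m1 \o ysection A) y)%E => //.
by under eq_integral => x _ do rewrite /= A0; rewrite integral0.
Qed.

End Product.

(** Only [f] depends on the last coordinate. The cylinder over the points where [g] takes one of the
    finitely many exceptional values is null; off it, every fibre over a point of [D] is finite. *)
Lemma chord_zeros_null (d : measure_display) (T : measurableType d)
    (m : {measure set T -> \bar R}) (p : {poly {poly int}})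
    (D : set T) (f : T * RT -> R) (g : T -> R) :
  p != 0 -> measurable D -> measurable_fun setT f -> measurable_fun setT g ->
  (forall x S, D x -> finite_set S -> finite_set [set c | S (f (x, c))]) ->
  (forall S, finite_set S -> m (D `&` g @^-1` S) = 0%E) ->
  measurable [set t | D t.1 /\ chord_zeros p (f t, g t.1)] /\
  (m \x mu)%E [set t | D t.1 /\ chord_zeros p (f t, g t.1)] = 0%E.
Proof.
move=> p0 mD mf mg finf nullg; set A := [set t | _].
have [Q finQ finA] := finite_chord_zeros R p0.
have mg1 : measurable_fun setT (fun t : T * RT => g t.1).
  exact: (measurableT_comp mg measurable_fst).
have mA : measurable A.
  rewrite (_ : A = (fst @^-1` D) `&` [set t | chord_zeros p (f t, g t.1)]) //.
  apply: measurableI; last exact: measurable_chord_zeros.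
  by rewrite -[X in measurable X]setTI; apply: measurable_fst.
have mB : measurable (D `&` g @^-1` Q).
  apply: measurableI => //; rewrite -[X in measurable X]setTI; apply: mg => //.
  exact: finite_measurable.
pose M : {measure set (T * RT) -> \bar R} := (m \x mu)%E.
split=> //; suff /negligibleP : M.-negligible A by apply.
pose C : set (T * RT) := (D `&` g @^-1` Q) `*` setT.
apply: (negligibleS (A := C `|` (A `\` C))).
  move=> t At; have [Bt|nBt] := pselect ((D `&` g @^-1` Q) t.1).
    by left; split.
  by right; split=> // -[].
apply: negligibleU.
  apply/negligibleP; first exact: measurableX.
  transitivity (m (D `&` g @^-1` Q) * mu setT)%E.
    exact: product_measure1E.
  by rewrite nullg // mul0e.
apply/negligibleP.
  by apply: measurableD => //; apply: measurableX.
apply: product_measure_xsection0 => x.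
apply: finite_lebesgue_measure0.
have [Dx|nDx] := pselect (D x); last first.
  rewrite (_ : xsection _ _ = set0) //.
  by apply/seteqP; split=> c //; rewrite /xsection /= inE => -[[/nDx]].
have [Qgx|nQgx] := pselect (Q (g x)).
  rewrite (_ : xsection _ _ = set0) //.
  by apply/seteqP; split=> c //; rewrite /xsection /= inE => -[_ []].
have [gx0|gx0] := ltP 0 (g x); last first.
  rewrite (_ : xsection _ _ = set0) //.
  apply/seteqP; split=> c //; rewrite /xsection /= inE => -[[_ []]] /=.
  by move=> _; rewrite ltNge gx0.
apply: (sub_finite_set _ (finf x _ Dx (finA _ gx0 nQgx))).
by move=> c; rewrite /xsection /= inE => -[[_ H] _].
Qed.

Local Notation T3 := (RT * RT * RT)%type.
Local Notation mu2 := (mu \x mu)%E.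
Local Notation mu3 := (mu2 \x mu)%E.

Let plane_sigma_finite : sigma_finite setT mu2.
Proof.
pose I n : set RT := `[- n%:R, n%:R]%classic.
have mI n : measurable (I n) by exact: measurable_itv.
exists (fun n => I n `*` I n).
  apply/esym/seteqP; split=> // -[x y] _.
  exists (Num.truncn (`|x| + `|y|)).+1 => //=.
  have lt_xy := truncnS_gt (`|x| + `|y|).
  by split; rewrite /I /= in_itv /= -ler_norml; apply: le_trans (ltW lt_xy);
    rewrite ?lerDl ?lerDr.
move=> n; split; first exact: measurableX.
rewrite [X in (X < _)%E](product_measure1E mu mu (mI n) (mI n)).
have fin : (mu (I n) < +oo)%E.
  rewrite /I lebesgue_measure_itv /=; case: ifP => // _.
  by rewrite -EFinD ltry.
by apply: lte_mul_pinfty => //; rewrite ge0_fin_numE.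
Qed.

(** [mu2] with its sigma-finiteness attached, as required for slicing along the last coordinate. *)
Let plane_measure : {sigma_finite_measure set (RT * RT)%type -> \bar R} :=
  HB.pack_for (SigmaFiniteMeasure.type (RT * RT)%type R) mu2
    (Measure_isSigmaFinite.Build _ _ _ mu2 plane_sigma_finite).

(** Equal to [b / a] for positive [a]; the power is measurable on the whole line. *)
Let ratio (a b : R) : R := b * a `^ (-1).

Let measurable_ratio (d : measure_display) (T : measurableType d)
  (f g : T -> R) : measurable_fun setT f -> measurable_fun setT g ->
  measurable_fun setT (fun t => ratio (f t) (g t)).
Proof.
move=> mf mg; apply: measurable_funM => //.
exact: (measurableT_comp (measurable_powR (-1)) mf).
Qed.

Let ratioE a b : 0 < a -> ratio a b = b / a.
Proof. by move=> a0; rewrite /ratio powR_inv1 // ltW. Qed.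

Let finite_ratio_num a S : 0 < a -> finite_set S ->
  finite_set [set b | S (ratio a b)].
Proof.
move=> a0 finS; apply: (sub_finite_set _ (finite_image (fun r => r * a) finS)).
move=> b Sb; exists (ratio a b) => //.
by rewrite ratioE // divfK // gt_eqF.
Qed.

Let finite_ratio_den b S : finite_set S ->
  finite_set [set a | [/\ 0 < a, 0 < b & S (ratio a b)]].
Proof.
move=> finS; apply: (sub_finite_set _ (finite_image (fun r => b / r) finS)).
move=> a [a0 b0 Sb]; exists (ratio a b) => //.
by rewrite ratioE // invf_div mulrC divfK // gt_eqF.
Qed.

(** There is one conclusion for each choice of the largest length. If it is [a] or [b], one ratio
    does not involve [c], and the fibres are lines in the direction of [c]. If it is [c], both
    ratios involve [c]: the slice at a fixed [c] is treated as a plane, with fibres in the direction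
    of [b]. *)
Lemma chord_indep_ae : {ae mu3, forall t : T3,
  let a := t.1.1 in let b := t.1.2 in let c := t.2 in
  0 < a -> 0 < b -> 0 < c -> forall p, p != 0 ->
  [/\ eval_xy (chord_point (c / a)) (chord_point (b / a)) p != 0,
      eval_xy (chord_point (c / b)) (chord_point (a / b)) p != 0 &
      eval_xy (chord_point (b / c)) (chord_point (a / c)) p != 0]}.
Proof.
pose B1 p := [set t : T3 | 0 < t.1.1 /\
  chord_zeros p (ratio t.1.1 t.2, ratio t.1.1 t.1.2)].
pose B2 p := [set t : T3 | (0 < t.1.1 /\ 0 < t.1.2) /\
  chord_zeros p (ratio t.1.2 t.2, ratio t.1.2 t.1.1)].
pose B3 p := [set t : T3 | 0 < t.2 /\
  chord_zeros p (ratio t.2 t.1.2, ratio t.2 t.1.1)].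
have pos_measurable (d : measure_display) (T : measurableType d) (f : T -> R) :
    measurable_fun setT f -> measurable [set t | 0 < f t].
  move=> mf; rewrite (_ : [set t | _] = setT `&` f @^-1` `]0, +oo[).
    exact: mf.
  by apply/seteqP; split=> t /=; rewrite in_itv /= andbT // => -[].
have m11 : measurable_fun [set: T3] (fun t : T3 => t.1.1 : R).
  exact: (measurableT_comp measurable_idTR
    (measurableT_comp measurable_fst measurable_fst)).
have m12 : measurable_fun [set: T3] (fun t : T3 => t.1.2 : R).
  exact: (measurableT_comp measurable_idTR
    (measurableT_comp measurable_snd measurable_fst)).
have m3 : measurable_fun [set: T3] (fun t : T3 => t.2 : R).
  exact: (measurableT_comp measurable_idTR measurable_snd).
have n1 : measurable_fun [set: RT * RT] (fun t : RT * RT => t.1 : R).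
  exact: (measurableT_comp measurable_idTR measurable_fst).
have n2 : measurable_fun [set: RT * RT] (fun t : RT * RT => t.2 : R).
  exact: (measurableT_comp measurable_idTR measurable_snd).
have N1 p : p != 0 -> mu3.-negligible (B1 p).
  move=> p0; pose D := [set ab : RT * RT | 0 < ab.1].
  have [] := @chord_zeros_null _ _ mu2 p D (fun t => ratio t.1.1 t.2)
    (fun ab => ratio ab.1 ab.2) p0.
  - exact: pos_measurable.
  - exact: measurable_ratio.
  - exact: measurable_ratio.
  - by move=> x S Dx finS; apply: finite_ratio_num.
  - move=> S finS; apply: product_measure_xsection0 => a.
    apply: finite_lebesgue_measure0.
    have [a0|a0] := ltP 0 a.
      apply: (sub_finite_set _ (finite_ratio_num a0 finS)).
      by move=> b; rewrite /xsection /= inE => -[].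
    rewrite (_ : xsection _ _ = set0) //.
    apply/seteqP; split=> b //; rewrite /xsection /= inE => -[].
    by rewrite /D /= ltNge a0.
  - by move=> mB B0; apply/negligibleP.
have N2 p : p != 0 -> mu3.-negligible (B2 p).
  move=> p0; pose D := [set ab : RT * RT | 0 < ab.1 /\ 0 < ab.2].
  have [] := @chord_zeros_null _ _ mu2 p D (fun t => ratio t.1.2 t.2)
    (fun ab => ratio ab.2 ab.1) p0.
  - by apply: measurableI; apply: pos_measurable.
  - exact: measurable_ratio.
  - exact: measurable_ratio.
  - by move=> x S [_ Dx] finS; apply: finite_ratio_num.
  - move=> S finS; apply: product_measure_xsection0 => a.
    apply: finite_lebesgue_measure0.
    apply: (sub_finite_set _ (finite_ratio_den a finS)).
    by move=> b; rewrite /xsection /= inE => -[[]].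
  - by move=> mB B0; apply/negligibleP.
have N3 p : p != 0 -> mu3.-negligible (B3 p).
  move=> p0; have mB3 : measurable (B3 p).
    apply: measurableI; first exact: pos_measurable.
    by apply: measurable_chord_zeros; apply: measurable_ratio.
  apply/negligibleP => //.
  suff H : (plane_measure \x mu)%E (B3 p) = 0%E by exact: H.
  apply: product_measure_ysection0 => // c.
  have [c0|c0] := ltP 0 c; last first.
    rewrite (_ : ysection _ _ = set0) ?measure0 //.
    apply/seteqP; split=> ab //; rewrite /ysection /= inE => -[].
    by rewrite /= ltNge c0.
  have [] := @chord_zeros_null _ _ mu p setT (fun t => ratio c t.2)
    (fun a => ratio c a) p0.
  - exact: measurableT.
  - exact: measurable_ratio.
  - exact: measurable_ratio.
  - by move=> x S _ finS; apply: finite_ratio_num.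
  - move=> S finS; rewrite setTI; apply: finite_lebesgue_measure0.
    exact: finite_ratio_num.
  - move=> _ <-; congr (_ _); apply/seteqP.
    by split=> ab; rewrite /ysection /= inE => -[].
(* There are only countably many polynomials with integer coefficients, so all the exceptional sets
   together are still null. *)
pose B n := if unpickle n is Some p then
  (if p == 0 :> {poly {poly int}} then set0 else B1 p `|` B2 p `|` B3 p)
  else set0.
apply: (@negligibleS _ _ _ _ (\bigcup_n B n)); last first.
  apply: negligible_bigcup => n; rewrite /B; case: unpickle => [p|]; last first.
    exact: negligible_set0.
  case: eqVneq => [_|p0]; first exact: negligible_set0.
  by apply: negligibleU; [apply: negligibleU;
    [apply: N1 | apply: N2]|apply: N3].
move=> [[a b] c] /= H; apply: contrapT => nB; apply: H => /= a0 b0 c0 p p0.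
have {}nB : ~ (B1 p `|` B2 p `|` B3 p) (a, b, c).
  by move=> Bp; apply: nB; exists (pickle p) => //;
    rewrite /B pickleK (negPf p0).
split; apply/negP => /eqP ev0; apply: nB.
- by left; left; split=> //; rewrite /= !ratioE //; split=> //=;
    apply: divr_gt0.
- by left; right; split=> //; rewrite /= !ratioE //; split=> //=;
    apply: divr_gt0.
- by right; split=> //; rewrite /= !ratioE //; split=> //=; apply: divr_gt0.
Qed.

End NullSets.

(** * Scaling by the largest length *)

Section ThreeLengths.
Variables (R : realType) (V : finType) (e : rel V).

(** As [a] is the largest length, [b / a] and [c / a] are at most 1, within the range up to 2 in
    which chords of the unit circle exist. *)
Lemma drawing_of_side (a b c : R) :
  0 < a -> 0 < b <= a -> 0 < c <= a ->
  (forall p, p != 0 ->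
     eval_xy (chord_point (c / a)) (chord_point (b / a)) p != 0) ->
  simple_graph e -> outerplanar R e ->
  exists f : V -> R[i], degenerate_drawing f /\ uses_edge_lengths e f a b c.
Proof.
move=> a0 /andP[b0 ba] /andP[c0 ca] indep [e_sym e_irr].
move=> [p [g [emb [F [[z0 nDz0 defF] _ bdF]]]]]; rewrite defF in bdF.
have [addr addr_inj addr_adj] := farey_embedding e_sym e_irr
  (outerplanar_no_K4_minor e_sym emb nDz0 bdF)
  (outerplanar_no_K23_minor e_sym emb nDz0 bdF).
have ratio02 r : 0 < r <= a -> 0 <= r / a <= 2.
  move=> /andP[r0 ra]; rewrite divr_ge0 ?(ltW r0) ?(ltW a0) //=.
  by rewrite ler_pdivrMr //; lra.
have [nx dx] := chord_point_norms (ratio02 c (introT andP (conj c0 ca))).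
have [ny dy] := chord_point_norms (ratio02 b (introT andP (conj b0 ba))).
have [pos pos_inj pos_adj] := farey_drawing nx ny indep.
have aC0 : a%:C%C != 0 by rewrite fmorph_eq0 gt_eqF.
exists (fun v => a%:C%C * pos (addr v)); split.
  by move=> u v /(mulfI aC0) /pos_inj /addr_inj.
have len u v : farey_adj (addr u) (addr v) ->
    `|a%:C%C * pos (addr v) - a%:C%C * pos (addr u)|
      \in [:: a%:C%C; b%:C%C; c%:C%C].
  move=> /pos_adj; rewrite -mulrBr normrM dx dy.
  have -> : `|a%:C%C| = a%:C%C :> R[i] by rewrite ger0_norm // ler0c ltW.
  have scale r : a%:C%C * (r / a)%:C%C = r%:C%C :> R[i].
    by rewrite -rmorphM /= mulrC divfK // gt_eqF.
  by rewrite !inE => /or3P[]/eqP->; rewrite ?mulr1 ?scale eqxx ?orbT.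
by move=> u v /addr_adj[/len|/len]; rewrite // distrC.
Qed.

End ThreeLengths.

Theorem theorem1 (R : realType) :
  {ae ((@lebesgue_measure R \x @lebesgue_measure R)
       \x @lebesgue_measure R)%E, forall t : R * R * R,
    let a := t.1.1 in let b := t.1.2 in let c := t.2 in
    0 < a < 1 -> 0 < b < 1 -> 0 < c < 1 ->
    forall (V : finType) (e : rel V),
      simple_graph e -> outerplanar R e ->
      exists f : V -> R[i],
        degenerate_drawing f /\ uses_edge_lengths e f a b c}.
Proof.
apply: filterS (chord_indep_ae R) => -[[a b] c] /= indep.
move=> /andP[a0 _] /andP[b0 _] /andP[c0 _] V e sg og.
have {}indep := indep a0 b0 c0.
(* The set of lengths is symmetric: only the order of the list changes when [b] or [c] takes the
   role of the side. *)
have side_b : a <= b -> c <= b -> exists f : V -> R[i],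
    degenerate_drawing f /\ uses_edge_lengths e f a b c.
  move=> ab cb; have [||||||f [inj len]] := @drawing_of_side R V e b a c.
  - exact: b0.
  - by rewrite a0.
  - by rewrite c0.
  - by move=> p /indep[].
  - exact: sg.
  - exact: og.
  by exists f; split=> // u v /len; rewrite !inE orbCA.
have side_c : a <= c -> b <= c -> exists f : V -> R[i],
    degenerate_drawing f /\ uses_edge_lengths e f a b c.
  move=> ac bc; have [||||||f [inj len]] := @drawing_of_side R V e c a b.
  - exact: c0.
  - by rewrite a0.
  - by rewrite b0.
  - by move=> p /indep[].
  - exact: sg.
  - exact: og.
  by exists f; split=> // u v /len; rewrite !inE orbC -orbA.
have [ba|/ltW ab] := leP b a; have [ca|/ltW ac] := leP c a.
- by apply: drawing_of_side; rewrite ?b0 ?c0 // => p /indep[].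
- by apply: side_c => //; apply: le_trans ac.
- by apply: side_b => //; apply: le_trans ab.
- by have [cb|/ltW bc] := leP c b; [apply: side_b | apply: side_c].
Qed.
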